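(* Let $G=(V,E)$ be a finite directed graph with source $s\in V$ and destination $d\in V$ such that every node is connected to $s$, let $H=[0,t_f]$, and assume a dynamic flow model as described in the context. Then every edge $s$,$d$-flow $g\in L_+(H)^E$ admits a flow decomposition.
   Context: $H=[0,t_f]$ carries its Borel $\sigma$-algebra $\mathcal B(H)$ and Lebesgue measure $\sigma$; $L(H)$ is the space of (equivalence classes of) Lebesgue integrable real functions on $H$ and $L_+(H)$ its nonnegative elements; inequalities between such functions are meant almost everywhere. A walk is a tuple $w=(e_1,\dots,e_k)$ of edges with $e_j=(v_j,v_{j+1})\in E$; write $w[j]=e_j$ and $|w|=k$. A cycle is a walk whose first edge leaves and whose last edge enters the same node; it is simple if for every node $v$ at most one edge of the walk leaves $v$. $\hat{\mathcal W}$ is the (countable) set of $s$,$d$-walks and $\mathcal C$ the finite set of simple cycles. $\delta^+(v)$, $\delta^-(v)$ denote the edges leaving, resp. entering $v$. Flow model: every $g\in L_+(H)^E$ induces nonnegative, absolutely continuous edge traversal time functions $D_e(g,\cdot):H\to[0,\infty)$, $e\in E$, such that the exit time functions $T_e(g,t):=t+D_e(g,t)$ are nondecreasing (FIFO). For a walk $w$ define $A_{w,1}(g,\cdot)=\mathrm{id}$ and $A_{w,j}(g,\cdot)=T_{w[j-1]}(g,\cdot)\circ\dots\circ T_{w[1]}(g,\cdot)$ for $2\le j\le |w|+1$. An edge $s$,$d$-flow is a $g\in L_+(H)^E$ such that for every $v\in V$ there is $r_v\in L(H)$ with $\sum_{e\in\delta^+(v)}\int_{[0,t]}g_e\,d\sigma-\sum_{e\in\delta^-(v)}\int_{T_e(g,\cdot)^{-1}([0,t])}g_e\,d\sigma=\int_{[0,t]}r_v\,d\sigma$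 for all $t\in H$, where $r_s\ge0$, $r_d\le 0$ and $r_v=0$ for $v\notin\{s,d\}$. A flow decomposition of an edge $s$,$d$-flow $g$ is a family $h=(h_w)_{w\in\hat{\mathcal W}\cup\mathcal C}$ with $h_w\in L_+(H)$ such that for all $e\in E$ and $t\in H$: $\int_0^t g_e\,d\sigma=\sum_{w\in\hat{\mathcal W}\cup\mathcal C}\sum_{j:\,w[j]=e}\int_{A_{w,j}(g,\cdot)^{-1}([0,t])}h_w\,d\sigma$, and every $h_c$, $c\in\mathcal C$, is a zero-cycle inflow rate, i.e. for almost all $t$, $h_c(t)>0$ implies $D_e(g,t)=0$ for all edges $e$ of $c$.
   Formalization: Adds: on each edge from whose head d is unreachable, almost all flow leaves the edge within H (g_e>0 implies T_e≤t_f). Without it the claim fails when exit times may exceed t_f (flow stuck on an edge to a dead end); it is automatic if every T_e maps H into H. *)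

(* Defs.v *)
From HB Require Import structures.
From mathcomp Require Import all_boot all_order all_algebra.
From mathcomp Require Import all_classical all_reals all_analysis.

Set Implicit Arguments.
Unset Strict Implicit.
Unset Printing Implicit Defensive.
Import Order.TTheory GRing.Theory Num.Theory.
Import numFieldNormedType.Exports.

Local Open Scope classical_set_scope.
Local Open Scope ring_scope.

Section Walks.
Context {V : finType} (E : {set V * V}).

Definition edge := {e : V * V | e \in E}.

Definition tail (e : edge) : V := (val e).1.
Definition head (e : edge) : V := (val e).2.

Definition adj : rel V := [rel u v | (u, v) \in E].

Definition is_walk (w : seq edge) : bool :=
  if w is e :: p then path (fun e1 e2 => head e1 == tail e2) e p else false.

Definition walk_from_to (u v : V) (w : seq edge) : bool :=
  is_walk w && (if w is e :: p then (tail e == u) && (head (last e p) == v)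
                else false).

Definition is_cycle (w : seq edge) : bool :=
  [exists v : V, walk_from_to v v w].

(* [uniq] ranges over positions: a cycle run through twice is not simple. *)
Definition is_simple_cycle (w : seq edge) : bool :=
  is_cycle w && uniq [seq tail e | e <- w].

Definition sd_walks (s d : V) : set (seq edge) := [set w | walk_from_to s d w].
Definition simple_cycles : set (seq edge) := [set w | is_simple_cycle w].

End Walks.

Arguments sd_walks {V} E s d.
Arguments simple_cycles {V} E.

Section FunctionsOnHorizon.
Context {R : realType} (tf : R).

Definition horizon : set R := `[0, tf].

(* Elements of L(H) are represented by functions on R of which only the values
   on H matter, up to null sets. *)
Definition L (f : R -> R) : Prop :=
  lebesgue_measure.-integrable horizon (EFin \o f).

Definition ae_on (P : R -> Prop) : Prop :=
  {ae lebesgue_measure, forall t : R, horizon t -> P t}.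

Definition Lplus (f : R -> R) : Prop := L f /\ ae_on (fun t => 0 <= f t).

Definition absolutely_continuous (f : R -> R) : Prop :=
  forall eps : R, 0 < eps -> exists2 delta : R, 0 < delta &
    forall (n : nat) (a b : 'I_n -> R),
      (forall i, 0 <= a i /\ a i <= b i /\ b i <= tf) ->
      (forall i j, i != j -> b i <= a j \/ b j <= a i) ->
      \sum_(i < n) (b i - a i) < delta ->
      \sum_(i < n) `|f (b i) - f (a i)| < eps.

End FunctionsOnHorizon.

Section FlowModel.
Context {R : realType} (tf : R) {V : finType} (E : {set V * V}).

Definition edge_rates := edge E -> R -> R.

Definition LplusE (g : edge_rates) : Prop := forall e, Lplus tf (g e).

Definition exit_time (D : edge_rates -> edge_rates) (g : edge_rates)
  (e : edge E) (t : R) : R := t + D g e t.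

(* The first clause says that [D g] on H depends only on the a.e. class of [g].
   Nothing is said about the values of [D g e] outside H. *)
Record flow_model (D : edge_rates -> edge_rates) : Prop := FlowModel {
  delay_ae_eq : forall g g' : edge_rates, LplusE g -> LplusE g' ->
    (forall e, ae_on tf (fun t => g e t = g' e t)) ->
    forall e t, horizon tf t -> D g e t = D g' e t ;
  delay_ge0 : forall g, LplusE g ->
    forall e t, horizon tf t -> 0 <= D g e t ;
  delay_abs_cont : forall g, LplusE g ->
    forall e, absolutely_continuous tf (D g e) ;
  exit_time_fifo : forall g, LplusE g ->
    forall e t t', horizon tf t -> horizon tf t' -> t <= t' ->
      exit_time D g e t <= exit_time D g e t' }.

Variables (D : edge_rates -> edge_rates) (g : edge_rates).

(* Positions are counted from 0: [arrival w j] is the time of reaching the tail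
   of the edge at position j, i.e. A_{w,j+1} in 1-based notation. *)
Definition arrival (w : seq (edge E)) (j : nat) (t : R) : R :=
  foldl (fun x e => exit_time D g e x) t (take j w).

(* The traversal times live on H only, so the composition defining
   [arrival w j] is defined at x iff x and all earlier arrival times are in H. *)
Definition arrival_preimage (w : seq (edge E)) (j : nat) (t : R) : set R :=
  [set x | horizon tf x /\ (forall i, (i < j)%N -> horizon tf (arrival w i x)) /\
           arrival w j x \in `[0, t]].

Definition exit_preimage (e : edge E) (t : R) : set R :=
  [set x | horizon tf x /\ exit_time D g e x \in `[0, t]].

Definition sd_flow (s d : V) : Prop :=
  LplusE g /\
  forall v : V, exists r : R -> R,
    [/\ L tf r,
        forall t, horizon tf t ->
          \sum_(e : edge E | tail e == v)
             \int[lebesgue_measure]_(x in `[0, t]) g e x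
          - \sum_(e : edge E | head e == v)
             \int[lebesgue_measure]_(x in exit_preimage e t) g e x
          = \int[lebesgue_measure]_(x in `[0, t]) r x,
        v = s -> ae_on tf (fun t => 0 <= r t),
        v = d -> ae_on tf (fun t => r t <= 0) &
        v != s -> v != d -> ae_on tf (fun t => r t = 0)].

(* Flow on an edge from whose head d cannot be reached leaves that edge within
   H. Vacuous if every node reaches d, and automatic if the exit times map H to
   H. Without it decompositions need not exist: flow entering an edge (s,v) with
   v a dead end and all exit times beyond t_f is balanced on H, but lies on no
   s,d-walk and no cycle. It is necessary for a decomposition to exist: such an
   edge is on no s,d-walk, so all its flow comes from zero-cycle inflow rates. *)
Definition no_stranded_flow (d : V) : Prop :=
  forall e : edge E, ~~ connect (adj E) (head e) d ->
    ae_on tf (fun t => 0 < g e t -> exit_time D g e t <= tf).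

Definition zero_cycle_inflow (c : seq (edge E)) (hc : R -> R) : Prop :=
  ae_on tf (fun t => 0 < hc t -> forall e, e \in c -> D g e t = 0).

Definition flow_decomposition (s d : V) (h : seq (edge E) -> R -> R) : Prop :=
  let WC := sd_walks E s d `|` simple_cycles E in
  [/\ forall w, WC w -> Lplus tf (h w),
      forall e t, horizon tf t ->
        (\int[lebesgue_measure]_(x in `[0, t]) g e x)%:E =
        \esum_(w in WC)
          (\sum_(j < size w | tnth (in_tuple w) j == e)
             \int[lebesgue_measure]_(x in arrival_preimage w j t) h w x)%:E &
      forall c, simple_cycles E c -> zero_cycle_inflow c (h c)].

End FlowModel.

(* Main.v *)
(** Route every particle through the network as a Markov chain: a particle
    reaching a node [v] at time [x] leaves along [e] with probability
    [g_e(x) / b_v(x)], where [b_v] is the total flow through [v], and at the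
    destination it stops with the remaining probability.  Conservation of [g]
    says that [g] is stationary for this chain with source [r_s], so the visits
    of the particles started with rate [r_s] are dominated by [g].  Their
    expected number is finite, hence almost every particle stops at [d] or runs
    past the horizon on an edge from which [d] is reachable, and [h_w] is [r_s]
    times the probability of following [w] (a particle lost beyond the horizon
    is credited to a walk continued arbitrarily to [d], where it is never
    counted again).

    The part [k] of [g] not explained by these walks is invariant under the
    chain without any source.  Comparing total masses, nothing of it stops or
    leaves the horizon; comparing the mean time of entering and of leaving
    edges, [T_e(x) = x] wherever [k_e(x) > 0].  So [k] is, for almost every [x],
    a static circulation on edges of zero delay, which is peeled off along
    simple cycles. *)

Require Import Defs.
From HB Require Import structures.
From mathcomp Require Import all_boot all_order all_algebra.
From mathcomp Require Import all_classical all_reals all_analysis.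
From mathcomp Require Import measurable_realfun simple_functions.
From mathcomp Require Import measurable_fun_approximation.
From mathcomp Require Import finmap.
From mathcomp Require Import ring lra.
Import Order.TTheory GRing.Theory Num.Theory.
Import numFieldNormedType.Exports HBSimple HBNNSimple.
Set Implicit Arguments.
Unset Strict Implicit.
Unset Printing Implicit Defensive.
Local Open Scope classical_set_scope.
Local Open Scope ring_scope.

(** * Measures from functionals on nonnegative functions *)

(** An exit time function may be constant on an interval, so the image of a rate under it need not
    have a density, and particles cannot simply be pushed forward as functions of time. The chain is
    therefore run on nonnegative test functions: [step] is its transition operator, [wsum g] is
    integration against [g], and flows are compared as functionals. Stationarity reads [wsum g f =
    wsum source f + wsum g (step f)]. Iterating it bounds the visits by [wsum g f], and this
    domination is what yields a density, by Radon-Nikodym.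

    The comparisons of masses are cancellations of finite quantities: if [wsum k f] is finite and
    equal to [wsum k (step f)], while [f] and [step f] differ by something of constant sign where
    [k > 0], then that difference vanishes almost everywhere there. Taking [f = 1] works because
    transition probabilities add up to at most 1; taking the entering time works because delays are
    nonnegative, once exits are excluded. The same kind of cancellation, applied to the probability
    of never ending, shows that almost no particle travels forever. *)

Section MeasureFunctional.
Context {d} {T : measurableType d} {R : realType}.
Local Open Scope ereal_scope.

Definition nnmeas (f : T -> \bar R) :=
  measurable_fun setT f /\ forall x, 0 <= f x.

(** Countable additivity and scaling are what can be checked for expected visits before any measure
    is at hand. [mf_ge0] does not ask for measurability because a measure in the library is
    nonnegative on every set. *)
Record measure_functional (Phi : (T -> \bar R) -> \bar R) : Prop :=
  MeasureFunctional {
  mf_ge0 : forall f, (forall x, 0 <= f x) -> 0 <= Phi f ;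
  mf_scale : forall f (k : R), nnmeas f -> (0 <= k)%R ->
    Phi (fun x => k%:E * f x) = k%:E * Phi f ;
  mf_series : forall f_ : nat -> T -> \bar R, (forall n, nnmeas (f_ n)) ->
    Phi (fun x => \sum_(n <oo) f_ n x) = \sum_(n <oo) Phi (f_ n) }.

Lemma nnmeas_indic (A : set T) : measurable A -> nnmeas (fun x => (\1_A x)%:E).
Proof.
move=> mA; split; last by move=> x; rewrite lee_fin.
by apply/measurable_EFinP; exact: measurable_indic.
Qed.

Lemma nneseries2 (u : nat -> \bar R) : (forall n, 0 <= u n) ->
  (forall n, u n.+2 = 0) -> \sum_(n <oo) u n = u 0%N + u 1%N.
Proof.
move=> u0 uz; rewrite (nneseries_split 0%N 2)// add0n eseries0; last first.
  by move=> [|[|i]].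
by rewrite adde0 !big_nat_recr//= big_nil add0e.
Qed.

Section rep.
Variables (Phi : (T -> \bar R) -> \bar R) (mfPhi : measure_functional Phi).

Lemma mf0 : Phi (fun _ => 0) = 0.
Proof.
rewrite -[RHS](mul0e (Phi (fun _ => 0))) -(mf_scale mfPhi)//.
by congr Phi; apply/funext => x; rewrite mule0.
Qed.

Lemma mfD f g : nnmeas f -> nnmeas g ->
  Phi (fun x => f x + g x) = Phi f + Phi g.
Proof.
move=> nf ng.
pose u n := match n with 0%N => f | 1%N => g | _ => fun _ => 0 end.
have nu n : nnmeas (u n).
  by case: n => [//|[//|n]]; split => //; exact: measurable_cst.
have := mf_series mfPhi nu.
rewrite nneseries2//; last 2 first.
- by move=> n; apply: (mf_ge0 mfPhi); case: (nu n).
- by move=> n; exact: mf0.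
move=> <-; congr Phi; apply/funext => x.
by rewrite nneseries2// => n; case: (nu n).
Qed.

Lemma mf_sum (I : Type) (s : seq I) (f : I -> T -> \bar R) :
  (forall i, nnmeas (f i)) ->
  Phi (fun x => \sum_(i <- s) f i x) = \sum_(i <- s) Phi (f i).
Proof.
move=> nf; elim: s => [|a s ih].
  by rewrite big_nil -[RHS]mf0; congr Phi; apply/funext => x; rewrite big_nil.
rewrite big_cons -ih -mfD//; last first.
  split; first by apply: emeasurable_sum => i; case: (nf i).
  by move=> x; apply: sume_ge0 => i _; case: (nf i).
by congr Phi; apply/funext => x; rewrite big_cons.
Qed.

(** The proof is an argument so that the measure instance can be found from the term itself. *)
Definition mf_set of measure_functional Phi :=
  fun A : set T => Phi (fun x => (\1_A x)%:E).

Local Notation nu := (mf_set mfPhi).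

Let nu0 : nu set0 = 0.
Proof.
by rewrite /mf_set -mf0; congr Phi; apply/funext => x; rewrite indic0.
Qed.

Let nu_ge0 A : 0 <= nu A.
Proof. by apply: (mf_ge0 mfPhi) => x; rewrite lee_fin. Qed.

Let nu_sigma : semi_sigma_additive nu.
Proof.
move=> F mF tF mUF.
have -> : nu (\bigcup_n F n) = \sum_(n <oo) nu (F n).
  rewrite /mf_set -(mf_series mfPhi) => [|n]; last exact: nnmeas_indic.
  congr Phi; apply/funext => x.
  by rewrite indic_bigcup.
by apply: is_cvg_nneseries => n _ _; exact: nu_ge0.
Qed.

HB.instance Definition _ := isMeasure.Build _ _ _ nu nu0 nu_ge0 nu_sigma.

Lemma mf_sfun (h : {sfun T >-> R}) : (forall x, (0 <= h x)%R) ->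
  Phi (fun x => (h x)%:E) = \int[nu]_x (h x)%:E.
Proof.
move=> h0.
have nn_ (g : {sfun T >-> R}) (y : R) :
  nnmeas (fun x => (\1_(g @^-1` [set y]) x)%:E) :> Prop by exact: nnmeas_indic.
(* The summands must be nonnegative for every real [y], not only for the values of [h]; hence
   [Num.max y 0]. *)
have hE : (fun x => (h x)%:E) = (fun x =>
    \sum_(y <- fset_set (range h)) (Num.max y 0)%:E * (\1_(h @^-1` [set y]) x)%:E).
  apply/funext => x; rewrite [in LHS](fimfunE h) fsbig_finite//= -sumEFin.
  apply: eq_big_seq => y; rewrite in_fset_set// => /set_mem[z _ <-].
  by rewrite EFinM (max_idPl _).
rewrite hE mf_sum; last first.
  move=> y; split => [|x]; first by apply: measurable_funeM; case: (nn_ h y).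
  by rewrite mule_ge0// lee_fin// le_max lexx orbT.
rewrite ge0_integral_sum//; last 2 first.
- by move=> y; apply: measurable_funeM; case: (nn_ h y).
- by move=> y x _; rewrite mule_ge0// lee_fin// le_max lexx orbT.
apply: eq_bigr => y _.
have m0 : (0 <= Num.max y 0)%R by rewrite le_max lexx orbT.
rewrite (mf_scale mfPhi)// ge0_integralZl_EFin//; last first.
  by case: (nn_ h y).
by rewrite integral_indic// setIT.
Qed.

(** The increments of an increasing approximation by simple functions are again nonnegative simple
    functions, so [f] is a series of them and countable additivity does the work of monotone
    convergence. *)
Lemma mf_integral f : nnmeas f -> Phi f = \int[nu]_x f x.
Proof.
move=> [mf f0].
pose g := nnsfun_approx measurableT mf.
pose u n : {sfun T >-> R} := if n is k.+1 then
    ((g k.+1 : {sfun T >-> R}) - (g k : {sfun T >-> R}))%R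
  else g 0%N.
have u0 n x : (0 <= u n x)%R.
  case: n => [|n] /=; first exact: fun_ge0.
  rewrite subr_ge0; exact/lefP/nd_nnsfun_approx.
have su n x : (\sum_(0 <= i < n.+1) u i x = g n x)%R.
  elim: n => [|n ih]; first by rewrite big_nat1.
  by rewrite big_nat_recr//= ih /= addrC subrK.
have fE : f = (fun x => \sum_(n <oo) (u n x)%:E).
  apply/funext => x; apply/esym/cvg_lim => //.
  rewrite -(cvg_shiftn 1).
  under eq_fun do rewrite addn1 sumEFin su.
  by apply: cvg_nnsfun_approx.
have nu_ n : nnmeas (fun x => (u n x)%:E).
  by split=> [|x]; [exact/measurable_EFinP|rewrite lee_fin].
rewrite fE (mf_series mfPhi)// integral_nneseries//; last 2 first.
- by move=> n; case: (nu_ n).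
- by move=> n x _; case: (nu_ n).
apply: eq_eseriesr => n _; exact: mf_sfun.
Qed.

End rep.
End MeasureFunctional.

Section MeasureFunctionalTheory.
Context {d} {T : measurableType d} {R : realType}.
Local Open Scope ereal_scope.
Implicit Types (f g : T -> \bar R) (Phi Psi : (T -> \bar R) -> \bar R).

Lemma nnmeas_cst (c : \bar R) : 0 <= c -> nnmeas (fun _ : T => c).
Proof. by move=> c0; split => //; exact: measurable_cst. Qed.

Lemma nnmeasD f g : nnmeas f -> nnmeas g -> nnmeas (fun x => f x + g x).
Proof.
move=> [mf f0] [mg g0]; split; first exact: emeasurable_funD.
by move=> x; exact: adde_ge0.
Qed.

Lemma nnmeasM f g : nnmeas f -> nnmeas g -> nnmeas (fun x => f x * g x).
Proof.
move=> [mf f0] [mg g0]; split; first exact: emeasurable_funM.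
by move=> x; exact: mule_ge0.
Qed.

Lemma nnmeas_sum (I : Type) (s : seq I) (f : I -> T -> \bar R) :
  (forall i, nnmeas (f i)) -> nnmeas (fun x => \sum_(i <- s) f i x).
Proof.
move=> nf; split; first by apply: emeasurable_sum => i; case: (nf i).
by move=> x; apply: sume_ge0 => i _; case: (nf i).
Qed.

Lemma nnmeas_sum_cond (I : Type) (s : seq I) (P : pred I) (f : I -> T -> \bar R) :
  (forall i, nnmeas (f i)) -> nnmeas (fun x => \sum_(i <- s | P i) f i x).
Proof.
move=> nf; under eq_fun do rewrite big_mkcond; apply: nnmeas_sum => i.
by case: (P i) => //; exact: nnmeas_cst.
Qed.

Lemma nnmeas_series (f : nat -> T -> \bar R) :
  (forall n, nnmeas (f n)) -> nnmeas (fun x => \sum_(n <oo) f n x).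
Proof.
move=> nf; split.
  rewrite [X in measurable_fun _ X](_ : _ =
    (fun x => \sum_(n <oo | n \in predT) f n x)); last first.
    by apply/funext => x; apply: eq_eseriesl.
  by apply: ge0_emeasurable_sum => [k x _ _|k _]; case: (nf k).
by move=> x; apply: nneseries_ge0 => n _ _; case: (nf n).
Qed.

Lemma mf_le Phi f g : measure_functional Phi -> nnmeas f -> nnmeas g ->
  (forall x, f x <= g x) -> Phi f <= Phi g.
Proof.
move=> mP nf ng fg; rewrite !(mf_integral mP)//.
case: nf => mf f0; case: ng => mg g0; exact: ge0_le_integral.
Qed.

Lemma mf_eq_indic Phi Psi : measure_functional Phi -> measure_functional Psi ->
  (forall A, measurable A ->
    Phi (fun x => (\1_A x)%:E) = Psi (fun x => (\1_A x)%:E)) ->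
  forall f, nnmeas f -> Phi f = Psi f.
Proof.
move=> mP mQ PQ f nf; rewrite (mf_integral mP nf) (mf_integral mQ nf).
by apply: eq_measure_integral => A mA _; exact: PQ.
Qed.

Lemma mf_add Phi Psi : measure_functional Phi -> measure_functional Psi ->
  measure_functional (fun f => Phi f + Psi f).
Proof.
move=> mP mQ; split.
- by move=> f f0; rewrite adde_ge0// ?(mf_ge0 mP)// (mf_ge0 mQ).
- move=> f k nf k0; rewrite (mf_scale mP)// (mf_scale mQ)// ge0_muleDr//.
    by apply: (mf_ge0 mP); case: nf.
  by apply: (mf_ge0 mQ); case: nf.
- move=> f nf; rewrite (mf_series mP)// (mf_series mQ)// nneseriesD//.
    by move=> i _ _; apply: (mf_ge0 mP); case: (nf i).
  by move=> i _ _; apply: (mf_ge0 mQ); case: (nf i).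
Qed.

Lemma mf_zero : measure_functional (fun _ : T -> \bar R => 0).
Proof.
split=> [//|f k _ _|f _]; first by rewrite mule0.
by rewrite eseries0.
Qed.

Lemma mf_sum_fun (I : Type) (s : seq I) (P : pred I)
    (Phi : I -> (T -> \bar R) -> \bar R) :
  (forall i, measure_functional (Phi i)) ->
  measure_functional (fun f => \sum_(i <- s | P i) Phi i f).
Proof.
move=> mP; elim: s => [|i s ih].
  rewrite [X in measure_functional X](_ : _ = fun=> 0); first exact: mf_zero.
  by apply/funext => f; rewrite big_nil.
rewrite [X in measure_functional X](_ : _ =
  fun f => (if P i then Phi i f else 0) + \sum_(i <- s | P i) Phi i f).
  by apply: mf_add => //; case: (P i) => //; exact: mf_zero.
by apply/funext => f; rewrite big_cons; case: (P i); rewrite ?add0e.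
Qed.

(** With [S] the identity this is integration against a density; with [S] an exit time, integration
    against the flow as it leaves an edge. *)
Lemma mf_int {d'} {U : measurableType d'} (mu : {measure set U -> \bar R})
    (S : U -> T) (w : U -> R) : measurable_fun setT S ->
  measurable_fun setT w -> (forall x, (0 <= w x)%R) ->
  measure_functional (fun f => \int[mu]_x (f (S x) * (w x)%:E)).
Proof.
move=> mS /measurable_EFinP mw w0.
have {}w0 x : 0 <= (w x)%:E by rewrite lee_fin.
have mfS f : nnmeas f -> nnmeas (fun x => f (S x)) => //.
  by move=> [mf f0]; split => // ; exact: measurableT_comp.
split.
- by move=> f f0; apply: integral_ge0 => x _; rewrite mule_ge0.
- move=> f k nf k0; rewrite -ge0_integralZl_EFin//.
  + by apply: eq_integral => x _; rewrite muleA.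
  + by move=> x _; rewrite mule_ge0//; case: nf.
  + by apply: emeasurable_funM => //; case: (mfS _ nf).
- move=> f nf; rewrite -integral_nneseries//.
  + apply: eq_integral => x _; rewrite muleC -nneseriesZl; last first.
      by move=> n _; case: (nf n).
    by apply: eq_eseriesr => n _; rewrite muleC.
  + by move=> n; apply: emeasurable_funM => //; case: (mfS _ (nf n)).
  + by move=> n x _; rewrite mule_ge0//; case: (nf n).
Qed.

Lemma mf_density (mu : {sigma_finite_measure set T -> \bar R}) Phi :
  measure_functional Phi -> Phi (fun _ => 1) < +oo ->
  (forall A, measurable A -> mu A = 0 -> Phi (fun x => (\1_A x)%:E) = 0) ->
  exists m : T -> R, [/\ measurable_fun setT m, forall x, (0 <= m x)%R &
    forall f, nnmeas f -> Phi f = \int[mu]_x (f x * (m x)%:E)].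
Proof.
move=> mP fin null.
have fn : fin_num_fun (mf_set mP).
  move=> A mA; rewrite ge0_fin_numE//; apply: le_lt_trans fin.
  apply: (mf_le mP) => //; [exact: nnmeas_indic|].
  by move=> x; rewrite lee_fin indicE; case: (_ \in _); rewrite ?ler01.
pose nu : {finite_measure set T -> \bar R} :=
  HB.pack_for (FiniteMeasure.type T R) (mf_set mP)
    (Measure_isFinite.Build _ _ _ (mf_set mP) fn).
have numu : nu `<< mu.
  by apply/null_content_dominatesP => A mA; exact: null.
pose F := Radon_Nikodym_SigmaFinite.f nu mu.
have Ffin x : (fine (F x))%:E = F x.
  by rewrite fineK//; exact: Radon_Nikodym_SigmaFinite.f_fin_num.
exists (fine \o F); split.
- apply: measurableT_comp => //.
  exact: measurable_int (Radon_Nikodym_SigmaFinite.f_integrable numu).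
- by move=> x; rewrite fine_ge0//; exact: Radon_Nikodym_SigmaFinite.f_ge0.
- move=> f nf; rewrite (mf_integral mP nf); case: nf => mf f0.
  rewrite -[LHS](Radon_Nikodym_SigmaFinite.change_of_variables numu)//.
  by apply: eq_integral => x _; rewrite /= Ffin.
Qed.

End MeasureFunctionalTheory.

(** The rays []t, +oo[] generate the Borel sets and are stable under intersection. Their masses are
    differences between the total mass and the mass of []-oo, t]], which makes sense because the
    total is finite. *)
Lemma mf_eq_ray {R : realType} (Phi Psi : (R -> \bar R) -> \bar R) :
  measure_functional Phi -> measure_functional Psi ->
  (Phi (fun _ => 1) < +oo)%E -> Phi (fun _ => 1%E) = Psi (fun _ => 1%E) ->
  (forall t, Phi (fun x => (\1_(`]-oo, t]) x)%:E) =
             Psi (fun x => (\1_(`]-oo, t]) x)%:E)) ->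
  forall f, nnmeas f -> Phi f = Psi f.
Proof.
move=> mP mQ fin tot PQ; apply: mf_eq_indic => // A mA.
have H (Chi : (R -> \bar R) -> \bar R) (t : R) : measure_functional Chi ->
  (Chi (fun x : R => (\1_(`]t, +oo[) x)%:E) + Chi (fun x => (\1_(`]-oo, t]) x)%:E)
   = Chi (fun _ => 1))%E.
  move=> mC; rewrite -(mfD mC); [|exact: nnmeas_indic..].
  congr Chi; apply/funext => x; rewrite -EFinD !indicE !mem_setE !in_itv/= andbT.
  by case: ltP; rewrite ?addr0 ?add0r.
have finI (Chi : (R -> \bar R) -> \bar R) (B : set R) : measure_functional Chi -> (Chi (fun _ => 1) < +oo)%E ->
    measurable B -> (Chi (fun x => (\1_B x)%:E) < +oo)%E.
  move=> mC fC mB; apply: le_lt_trans fC; apply: (mf_le mC).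
  - exact: nnmeas_indic.
  - by split => [|x]; [exact: measurable_cst|exact: lee01].
  - by move=> x; rewrite lee_fin indicE; case: (_ \in _); rewrite ?ler01.
pose G := @RGenOInfty.G R.
apply: (@measure_unique _ R _ G (fun n => `]- (n%:R), +oo[%classic)
  _ _ _ _ (mf_set mP) (mf_set mQ)) => //.
- exact: RGenOInfty.measurableE.
- move=> _ _ [x ->] [y ->]; exists (Num.max x y).
  by apply/seteqP; split => z /=; rewrite !in_itv/= !andbT gt_max => /andP.
- by move=> n; exists (- n%:R).
- apply/seteqP; split => // x _.
  exists (Num.truncn `|x|).+1 => //=; rewrite in_itv/= andbT ltrNl.
  by rewrite (le_lt_trans (ler_norm _))// normrN truncnS_gt.
- move=> _ [t ->]; rewrite /mf_set/=.
  have h1 := H _ t mP; have h2 := H _ t mQ.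
  have f2 : Psi (fun x => (\1_(`]-oo, t]) x)%:E) \is a fin_num.
    rewrite ge0_fin_numE; first by apply: finI => //; rewrite -tot.
    by apply: (mf_ge0 mQ) => x; rewrite lee_fin.
  move: h1; rewrite tot -h2 PQ => /(congr1 (fun z => z - Psi (fun x => (\1_(`]-oo, t]) x)%:E))%E).
  by rewrite !addeK.
- by move=> k; exact: finI.
Qed.

(** * Measurability and almost-everywhere arguments *)

Lemma measurable_funV {d} {T : measurableType d} {R : realType} (f : T -> R) :
  measurable_fun setT f -> (forall x, 0 <= f x) ->
  measurable_fun setT (fun x => (f x)^-1).
Proof.
move=> mf f0; under eq_fun do rewrite -powR_inv1//.
by apply: (measurableT_comp (measurable_powR _)).
Qed.

Lemma integral_indicM {d} {T : measurableType d} {R : realType}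
    (mu : {measure set T -> \bar R}) (B : set T) (f : T -> \bar R) :
  (\int[mu]_x ((\1_B x)%:E * f x) = \int[mu]_(x in B) f x)%E.
Proof.
rewrite [RHS]integral_mkcond; apply: eq_integral => x _.
by rewrite patchE indicE; case: (_ \in _); rewrite ?mul1e ?mul0e.
Qed.

Section AlmostEverywhere.
Context {d} {T : measurableType d} {R : realType}.
Variable mu : {measure set T -> \bar R}.
Local Open Scope ereal_scope.

Lemma ae_eq0_integral (f : T -> \bar R) : nnmeas f -> \int[mu]_x f x = 0 ->
  {ae mu, forall x, f x = 0}.
Proof.
move=> [mf f0] intf0.
have : \int[mu]_(x in setT) `|f x| = 0.
  by rewrite -[RHS]intf0; apply: eq_integral => x _; rewrite gee0_abs.
by move/(ae_eq_integral_abs mu measurableT mf); apply: filterS => x; exact.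
Qed.

(** Testing on the set [B] where [m] exceeds [g] gives the mass of [g] on [B] plus the whole excess
    on the left; the finite mass of [g] cancels, so the excess has integral 0. *)
Lemma ae_le_integral (m g : T -> R) : measurable_fun setT m ->
  measurable_fun setT g -> (forall x, 0 <= m x)%R -> (forall x, 0 <= g x)%R ->
  \int[mu]_x (g x)%:E < +oo ->
  (forall B, measurable B -> \int[mu]_(x in B) (m x)%:E <= \int[mu]_(x in B) (g x)%:E) ->
  {ae mu, forall x, (m x <= g x)%R}.
Proof.
move=> mm mg m0 g0 fin le.
pose B := [set x | (g x < m x)%R].
have mB : measurable B.
  rewrite (_ : B = ~` (setT `&` [set x | (m x <= g x)%R])).
    by apply: measurableC; exact: measurable_fun_le.
  by apply/seteqP; split=> x; rewrite /B setTI/= ltNge; move/negP.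
pose k x := (Num.max (m x - g x) 0)%R.
have nw (w : T -> R) : measurable_fun setT w -> (forall x, 0 <= w x)%R ->
    nnmeas (fun x => (w x)%:E).
  by move=> mw w0; split=> [|x]; [exact/measurable_EFinP|rewrite lee_fin].
have mk : measurable_fun setT k.
  apply: measurable_maxr => //; exact: measurable_funB.
have k0 x : (0 <= k x)%R by rewrite le_max lexx orbT.
have finB : \int[mu]_(x in B) (g x)%:E \is a fin_num.
  rewrite ge0_fin_numE; last by apply: integral_ge0 => x _; rewrite lee_fin.
  apply: le_lt_trans fin; apply: ge0_subset_integral => //.
    by case: (nw g).
  by move=> x _; rewrite lee_fin.
have : \int[mu]_x (k x)%:E = 0.
  apply/eqP; rewrite eq_le integral_ge0 ?andbT => [|x _]; last by rewrite lee_fin.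
  have := le B mB; rewrite (_ : \int[mu]_(x in B) (m x)%:E =
      \int[mu]_(x in B) (g x)%:E + \int[mu]_x (k x)%:E).
    by rewrite -[leRHS]adde0 leeD2lE.
  rewrite -[LHS]integral_indicM -[X in _ = X + _]integral_indicM.
  have nB := nnmeas_indic (R := R) mB.
  rewrite -ge0_integralD//.
  - apply: eq_integral => x _; rewrite -!EFinM -EFinD; congr EFin.
    rewrite /k indicE; case: (boolP (x \in B)) => [/set_mem xB|/negP xB].
      by rewrite !mul1r (max_idPl _) ?subr_ge0 1?ltW// addrC subrK.
    rewrite !mul0r (max_idPr _) ?addr0// subr_le0 leNgt.
    by apply/negP => lt; apply: xB; exact/mem_set.
  - by move=> x _; rewrite mule_ge0// lee_fin.
  - by case: (nnmeasM nB (nw _ mg g0)).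
  - by move=> x _; rewrite lee_fin.
  - by case: (nw _ mk k0).
move=> ik0; have := ae_eq0_integral (nw _ mk k0) ik0; apply: filterS => x.
by move=> [kx]; rewrite -subr_le0 -kx le_max lexx.
Qed.

End AlmostEverywhere.

Lemma nneseries_shift {R : realType} (u : nat -> \bar R) : (forall n, 0 <= u n)%E ->
  (\sum_(n <oo) u n = u 0%N + \sum_(n <oo) u n.+1)%E.
Proof.
move=> u0; rewrite [LHS](nneseries_recl (P := predT) (fun k _ => u0 k) isT).
congr (_ + _)%E; rewrite -(nneseries_addn 1 u0).
by apply: eq_eseriesr => n _; rewrite addn1.
Qed.

Lemma adde_fixed {R : realType} (x y : \bar R) : x \is a fin_num ->
  (x + y = x)%E -> y = 0%E.
Proof.
by move=> fx /(congr1 (fun z => (z - x)%E)); rewrite [(x + y)%E]addeC addeK// subee.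
Qed.

Section LebesgueAlmostEverywhere.
Context {R : realType}.
Local Notation mu := (@lebesgue_measure R).
Implicit Types P Q : R -> Prop.

Lemma ae_mono P Q : (forall x, P x -> Q x) ->
  {ae mu, forall x, P x} -> {ae mu, forall x, Q x}.
Proof. by move=> PQ; apply: filterS; first exact: (ae_filter_ringOfSetsType mu). Qed.

Lemma ae_and P Q : {ae mu, forall x, P x} -> {ae mu, forall x, Q x} ->
  {ae mu, forall x, P x /\ Q x}.
Proof. by move=> hP hQ; apply: filterI; first exact: (ae_filter_ringOfSetsType mu). Qed.

Lemma ae_true P : (forall x, P x) -> {ae mu, forall x, P x}.
Proof. by move=> hP; apply: filterE; first exact: (ae_filter_ringOfSetsType mu). Qed.

Lemma ae_forall (I : finType) (P : I -> R -> Prop) :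
  (forall i, {ae mu, forall x, P i x}) -> {ae mu, forall x, forall i, P i x}.
Proof.
move=> hP.
have h (s : seq I) : {ae mu, forall x, forall i, i \in s -> P i x}.
  elim: s => [|a s ih]; first exact: ae_true.
  apply: ae_mono (ae_and (hP a) ih) => x [Pa Ps] i.
  by rewrite inE => /predU1P[->|/Ps].
by apply: ae_mono (h (enum I)) => x + i; apply; rewrite mem_enum.
Qed.

Lemma ae_leb_eq0 (f : R -> \bar R) : nnmeas f -> (\int[mu]_x f x = 0)%E ->
  {ae mu, forall x, f x = 0%E}.
Proof. by move=> nf; apply: (@ae_eq0_integral _ (measurableTypeR R)). Qed.

End LebesgueAlmostEverywhere.

(** * The Markov chain of particles *)

Section Markov.
Context {R : realType} {A V : finType} (tl hd : A -> V).
Local Notation mu := (@lebesgue_measure R).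
Implicit Types f : A -> R -> \bar R.

Definition nns f := forall e, nnmeas (f e).

(** A state of the chain is an edge together with the time of entering it; [w] is a density on
    states and [f] a test function. *)
Definition wsum (w : A -> R -> R) f : \bar R :=
  (\sum_e \int[mu]_x (f e x * (w e x)%:E))%E.

Definition nnw (w : A -> R -> R) :=
  (forall e, measurable_fun setT (w e)) /\ (forall e x, 0 <= w e x).

Definition at_edge (e : A) (phi : R -> \bar R) : A -> R -> \bar R :=
  fun e' x => if e' == e then phi x else 0%E.

Local Open Scope ereal_scope.

Lemma nns_at e phi : nnmeas phi -> nns (at_edge e phi).
Proof. by move=> nphi e'; rewrite /at_edge; case: eqP => // _; exact: nnmeas_cst. Qed.

Lemma nns_series (f : nat -> A -> R -> \bar R) : (forall n, nns (f n)) ->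
  nns (fun e x => \sum_(n <oo) f n e x).
Proof. by move=> nf e; apply: nnmeas_series => n; exact: nf. Qed.

Section wsum.
Variables (w : A -> R -> R) (nw : nnw w).

Let mfw e : measure_functional (fun phi => \int[mu]_x (phi x * (w e x)%:E)).
Proof. by case: nw => mw w0; apply: mf_int; [exact: measurable_id|exact: mw|]. Qed.

Lemma wsum_ge0 f : (forall e x, 0 <= f e x) -> 0 <= wsum w f.
Proof. by move=> f0; apply: sume_ge0 => e _; exact: (mf_ge0 (mfw e)). Qed.

Lemma wsum_series (f : nat -> A -> R -> \bar R) : (forall n, nns (f n)) ->
  wsum w (fun e x => \sum_(n <oo) f n e x) = \sum_(n <oo) wsum w (f n).
Proof.
move=> nf; rewrite /wsum nneseries_sum; last first.
  by move=> e n _; apply: (@mf_ge0 _ _ _ _ (mfw e) (f n e)); case: (nf n e).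
by apply: eq_bigr => e _; exact: (mf_series (mfw e) (fun n => nf n e)).
Qed.

Lemma wsumD f g : nns f -> nns g ->
  wsum w (fun e x => f e x + g e x) = wsum w f + wsum w g.
Proof.
move=> nf ng; rewrite /wsum -big_split/=; apply: eq_bigr => e _.
exact: (mfD (mfw e) (nf e) (ng e)).
Qed.

Lemma wsumZ f k : nns f -> (0 <= k)%R ->
  wsum w (fun e x => k%:E * f e x) = k%:E * wsum w f.
Proof.
move=> nf k0; rewrite /wsum ge0_sume_distrr; last first.
  by move=> e _; apply: (@mf_ge0 _ _ _ _ (mfw e) (f e)); case: (nf e).
by apply: eq_bigr => e _; exact: (mf_scale (mfw e) (nf e) k0).
Qed.

Lemma wsum_le f g : nns f -> nns g -> (forall e x, f e x <= g e x) ->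
  wsum w f <= wsum w g.
Proof. by move=> nf ng fg; apply: lee_sum => e _; exact: (mf_le (mfw e) (nf e) (ng e)). Qed.

Lemma wsum_at e phi : nnmeas phi ->
  wsum w (at_edge e phi) = \int[mu]_x (phi x * (w e x)%:E).
Proof.
move=> nphi; rewrite /wsum (bigD1 e)//= big1 ?adde0; last first.
  move=> e' /negPf ne; rewrite integral0_eq// => x _.
  by rewrite /at_edge ne mul0e.
by apply: eq_integral => x _; rewrite /at_edge eqxx.
Qed.

End wsum.

Variables (inH : R -> bool) (T : A -> R -> R) (g : A -> R -> R) (r rn : V -> R -> R).
Hypothesis minH : measurable_fun setT inH.
Hypothesis mT : forall e, measurable_fun setT (T e).
Hypothesis ng : nnw g.
Hypotheses (mr : forall v, measurable_fun setT (r v)) (r0 : forall v x, (0 <= r v x)%R).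
Hypotheses (mrn : forall v, measurable_fun setT (rn v)) (rn0 : forall v x, (0 <= rn v x)%R).

Definition throughput v x : R := (\sum_(e | tl e == v) g e x + rn v x)%R.
Local Notation b := throughput.

(** Flow conservation in weak form. What stops at [v] is part of the throughput on the left, so that
    every term is nonnegative and no difference of extended reals occurs. *)
Hypothesis balance : forall v phi, nnmeas phi ->
  \int[mu]_x (phi x * (b v x)%:E) =
  \sum_(e | hd e == v)
    \int[mu]_x (phi (T e x) * (if inH (T e x) then g e x else 0%R)%:E)
  + \int[mu]_x (phi x * (r v x)%:E).

(** Where the throughput is [0], division by [0] makes all these probabilities
    [0], so that they do not add up to [1]. *)
Definition turn e x : R := (g e x / b (tl e) x)%R.
Definition leave v x : R := (rn v x / b v x)%R.
Local Notation p := turn.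

Lemma throughput_ge0 v x : (0 <= b v x)%R.
Proof. by rewrite addr_ge0// sumr_ge0// => e _; case: ng. Qed.

Lemma measurable_throughput v : measurable_fun setT (b v).
Proof.
apply: measurable_funD => //; under eq_fun do rewrite big_mkcond/=.
by apply: measurable_sum => e; case: (tl e == v) => //; case: ng.
Qed.

Lemma nnw_turn : nnw p.
Proof.
split => [e|e x]; last by rewrite divr_ge0// ?throughput_ge0//; case: ng.
apply: measurable_funM; first by case: ng.
apply: measurable_funV; [exact: measurable_throughput|exact: throughput_ge0].
Qed.

Lemma measurable_leave v : measurable_fun setT (leave v).
Proof.
apply: measurable_funM => //.
apply: measurable_funV; [exact: measurable_throughput|exact: throughput_ge0].
Qed.

Lemma leave_ge0 v x : (0 <= leave v x)%R.
Proof. by rewrite divr_ge0// throughput_ge0. Qed.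

Lemma turn_leave v x : b v x != 0%R ->
  (\sum_(e | tl e == v) p e x + leave v x = 1)%R.
Proof.
move=> b0; rewrite -[RHS](divff b0) /leave [in RHS]/throughput mulrDl mulr_suml.
by congr (_ + _)%R; apply: eq_bigr => e /eqP tle; rewrite /turn tle.
Qed.

Lemma turn_le1 v x : (\sum_(e | tl e == v) p e x + leave v x <= 1)%R.
Proof.
have [b0|b0] := eqVneq (b v x) 0%R; last by rewrite turn_leave.
rewrite big1 ?add0r /leave ?b0 ?invr0 ?mulr0// => e /eqP tle.
by rewrite /turn tle b0 invr0 mulr0.
Qed.

(** Division by a zero throughput is harmless: [b] is a sum of nonnegative terms, one of which is
    [g e], so it vanishes only where [g e] does. *)
Lemma turnK e x : (p e x * b (tl e) x = g e x)%R.
Proof.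
have [b0|b0] := eqVneq (b (tl e) x) 0%R; last by rewrite divfK.
rewrite b0 mulr0; apply/esym/eqP; rewrite eq_le; case: ng => _ g0.
rewrite g0 andbT -b0 /throughput (bigD1 e)//= -addrA lerDl.
by rewrite addr_ge0// sumr_ge0.
Qed.

Definition onward f v x := \sum_(e | tl e == v) (p e x)%:E * f e x.

(** The transition operator: the expected value of [f] at the next state, counted as 0 if the
    particle stops or runs past the horizon. *)
Definition step f : A -> R -> \bar R := fun e x =>
  if inH (T e x) then onward f (hd e) (T e x) else 0.

Definition source e x : R := (r (tl e) x * p e x)%R.

Lemma nnw_source : nnw source.
Proof.
have [mp p0] := nnw_turn; split => [e|e x]; last by rewrite mulr_ge0.
exact: measurable_funM.
Qed.

Lemma nnmeas_w w e : nnw w -> nnmeas (fun x => (w e x)%:E).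
Proof.
move=> [mw w0]; split; first by apply/measurable_EFinP.
by move=> x; rewrite lee_fin.
Qed.

Lemma nnmeas_onward f v : nns f -> nnmeas (onward f v).
Proof.
move=> nf; apply: nnmeas_sum_cond => e; apply: nnmeasM => //.
exact: nnmeas_w nnw_turn.
Qed.

Lemma nnmeas_if (phi psi : R -> \bar R) (c : R -> bool) : measurable_fun setT c ->
  nnmeas phi -> nnmeas psi -> nnmeas (fun x => if c x then phi x else psi x).
Proof.
move=> mc [mphi phi0] [mpsi psi0]; split; last by move=> x; case: ifP.
by apply: measurable_fun_ifT.
Qed.

Lemma nns_step f : nns f -> nns (step f).
Proof.
move=> nf e; apply: nnmeas_if; [exact: measurableT_comp| |exact: nnmeas_cst].
have [m1 m2] := nnmeas_onward (hd e) nf.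
by split => //; exact: measurableT_comp.
Qed.

Lemma onward_series (f : nat -> A -> R -> \bar R) v x : (forall n, nns (f n)) ->
  onward (fun e x => \sum_(n <oo) f n e x) v x = \sum_(n <oo) onward (f n) v x.
Proof.
move=> nf; have [_ p0] := nnw_turn; rewrite /onward nneseries_sum; last first.
  by move=> e n _; rewrite mule_ge0// ?lee_fin//; case: (nf n e).
apply: eq_bigr => e _; rewrite nneseriesZl// => n _.
by case: (nf n e).
Qed.

Lemma step_series (f : nat -> A -> R -> \bar R) : (forall n, nns (f n)) ->
  step (fun e x => \sum_(n <oo) f n e x) =
  (fun e x => \sum_(n <oo) step (f n) e x).
Proof.
move=> nf; apply/funext => e; apply/funext => x; rewrite /step.
by case: ifP => _; [exact: onward_series|rewrite eseries0].
Qed.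

Lemma stepD f h : nns f -> nns h ->
  step (fun e x => f e x + h e x) = (fun e x => step f e x + step h e x).
Proof.
move=> nf nh; apply/funext => e; apply/funext => x; rewrite /step.
case: ifP => _; last by rewrite adde0.
rewrite /onward -big_split/=; apply: eq_bigr => e' _.
by rewrite ge0_muleDr//; [case: (nf e')|case: (nh e')].
Qed.

Lemma stepZ f k : nns f -> (0 <= k)%R ->
  step (fun e x => k%:E * f e x) = (fun e x => k%:E * step f e x).
Proof.
move=> nf k0; have [_ p0] := nnw_turn.
apply/funext => e; apply/funext => x; rewrite /step.
case: ifP => _; last by rewrite mule0.
rewrite /onward ge0_sume_distrr; last first.
  by move=> e' _; rewrite mule_ge0// ?lee_fin//; case: (nf e').
by apply: eq_bigr => e' _; rewrite muleCA.
Qed.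

Lemma step_le f h : (forall e x, f e x <= h e x) ->
  forall e x, step f e x <= step h e x.
Proof.
move=> fh e x; rewrite /step; case: ifP => // _; apply: lee_sum => e' _.
by rewrite lee_wpmul2l// lee_fin; case: nnw_turn.
Qed.

(** Stationarity of [g]. By [turnK], [f] against [g] on the edges leaving [v] is [onward f v]
    against the throughput; [balance] splits this into the inflow, which gives [source], and the
    arrivals, which give [step f]. *)
Lemma wsum_step f : nns f -> wsum g f = wsum source f + wsum g (step f).
Proof.
move=> nf; have [mp p0] := nnw_turn; have [mg g0] := ng.
have nfp e : nnmeas (fun x => (p e x)%:E * f e x).
  by apply: nnmeasM => //; exact: nnmeas_w nnw_turn.
have part (F : A -> \bar R) (h : A -> V) :
    \sum_e F e = \sum_v \sum_(e | h e == v) F e.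
  by rewrite (partition_big h predT).
have onwardE (w : V -> R -> R) v : measurable_fun setT (w v) ->
      (forall x, (0 <= w v x)%R) ->
    \int[mu]_x (onward f v x * (w v x)%:E) =
    \sum_(e | tl e == v) \int[mu]_x (((p e x)%:E * f e x) * (w (tl e) x)%:E).
  move=> mw w0; rewrite [RHS]big_mkcond/=.
  transitivity (\int[mu]_x \sum_e (if tl e == v then
      ((p e x)%:E * f e x) * (w v x)%:E else 0)).
    apply: eq_integral => x _; rewrite -big_mkcond/= muleC ge0_sume_distrr.
      by apply: eq_bigr => e _; rewrite muleC.
    by move=> e _; case: (nfp e).
  have nn e : nnmeas (fun x => if tl e == v then
      ((p e x)%:E * f e x) * (w v x)%:E else 0).
    case: (tl e == v); last exact: nnmeas_cst.
    apply: nnmeasM => //; split; [exact/measurable_EFinP|].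
    by move=> x; rewrite lee_fin.
  rewrite ge0_integral_sum//; [|by move=> e; case: (nn e)|
    by move=> e x _; case: (nn e)].
  apply: eq_bigr => e _; case: eqP => [<- //|_]; exact: integral0.
rewrite {1}/wsum (part _ tl).
transitivity (\sum_v \int[mu]_x (onward f v x * (b v x)%:E)).
  apply: eq_bigr => v _; rewrite onwardE; last 2 first.
  - exact: measurable_throughput.
  - exact: throughput_ge0.
  apply: eq_bigr => e _; apply: eq_integral => x _.
  by rewrite -turnK EFinM [(p e x)%:E * f e x]muleC -muleA.
rewrite (eq_bigr _ (fun v _ => balance v (nnmeas_onward v nf))).
rewrite big_split/= addeC; congr (_ + _).
  rewrite [RHS](part _ tl); apply: eq_bigr => v _; rewrite onwardE//.
  apply: eq_bigr => e _.
  apply: eq_integral => x _.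
  rewrite /source EFinM [(p e x)%:E * f e x]muleC -muleA.
  by rewrite [(p e x)%:E * _]muleC.
rewrite [RHS](part _ hd); apply: eq_bigr => v _; apply: eq_bigr => e /eqP <-.
apply: eq_integral => x _; rewrite /step; case: ifP => //.
by rewrite mul0e mule0.
Qed.

Lemma nns_iter f k : nns f -> nns (iter k step f).
Proof. by move=> nf; elim: k => //= k; exact: nns_step. Qed.

Lemma iter_step_series (f : nat -> A -> R -> \bar R) k : (forall n, nns (f n)) ->
  iter k step (fun e x => \sum_(n <oo) f n e x) =
  (fun e x => \sum_(n <oo) iter k step (f n) e x).
Proof.
move=> nf; elim: k => //= k ->; apply: step_series => n; exact: nns_iter.
Qed.

Lemma iter_stepD f h k : nns f -> nns h ->
  iter k step (fun e x => f e x + h e x) =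
  (fun e x => iter k step f e x + iter k step h e x).
Proof. by move=> nf nh; elim: k => //= k ->; rewrite stepD//; exact: nns_iter. Qed.

Lemma iter_stepZ f c k : nns f -> (0 <= c)%R ->
  iter k step (fun e x => c%:E * f e x) = (fun e x => c%:E * iter k step f e x).
Proof. by move=> nf c0; elim: k => //= k ->; rewrite stepZ//; exact: nns_iter. Qed.

Lemma iter_step_le f h k : (forall e x, f e x <= h e x) ->
  forall e x, iter k step f e x <= iter k step h e x.
Proof. by move=> fh; elim: k => //= k; exact: step_le. Qed.

Lemma wsum_iter_step n f : nns f -> wsum g f =
  \sum_(0 <= k < n) wsum source (iter k step f) + wsum g (iter n step f).
Proof.
move=> nf; elim: n => [|n ih]; first by rewrite big_nil add0e.
by rewrite big_nat_recr//= -addeA -wsum_step//; exact: nns_iter.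
Qed.

(** * Expected visits of the particles, and the residual flow *)

Definition visits f := \sum_(k <oo) wsum source (iter k step f).

Let src_ge0 f k : nns f -> 0 <= wsum source (iter k step f).
Proof.
move=> nf; apply: wsum_ge0 => [|e x]; first exact: nnw_source.
by case: (nns_iter k nf e).
Qed.

Lemma visits_ge0 f : nns f -> 0 <= visits f.
Proof. by move=> nf; apply: nneseries_ge0 => k _ _; exact: src_ge0. Qed.

(** Unrolling stationarity [n] times leaves the nonnegative remainder [wsum g (iter n step f)] next
    to the partial sum of the visits. *)
Lemma visits_le_wsum f : nns f -> visits f <= wsum g f.
Proof.
move=> nf; apply: lime_le; first by apply: is_cvg_nneseries => n _ _; exact: src_ge0.
apply: nearW => n; rewrite (wsum_iter_step n nf) leeDl//.
apply: wsum_ge0 => // e x; by case: (nns_iter n nf e).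
Qed.

Lemma visits_rec f : nns f -> visits f = wsum source f + visits (step f).
Proof.
move=> nf; rewrite [LHS](nneseries_shift (fun k => src_ge0 k nf)).
by congr (_ + _); apply: eq_eseriesr => n _; rewrite iterSr.
Qed.

Lemma visits_series (f : nat -> A -> R -> \bar R) : (forall n, nns (f n)) ->
  visits (fun e x => \sum_(n <oo) f n e x) = \sum_(n <oo) visits (f n).
Proof.
move=> nf; rewrite /visits [RHS]nneseries_interchange; last first.
  by move=> i j; exact: src_ge0.
apply: eq_eseriesr => k _; rewrite iter_step_series// wsum_series//.
  exact: nnw_source.
by move=> n; exact: nns_iter.
Qed.

Lemma visitsD f h : nns f -> nns h ->
  visits (fun e x => f e x + h e x) = visits f + visits h.
Proof.
move=> nf nh; rewrite /visits -nneseriesD; [|by move=> *; exact: src_ge0..].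
apply: eq_eseriesr => k _; rewrite iter_stepD// wsumD//; try exact: nns_iter.
exact: nnw_source.
Qed.

Lemma visitsZ f c : nns f -> (0 <= c)%R ->
  visits (fun e x => c%:E * f e x) = c%:E * visits f.
Proof.
move=> nf c0; rewrite /visits -nneseriesZl; last by move=> *; exact: src_ge0.
apply: eq_eseriesr => k _; rewrite iter_stepZ// wsumZ//; try exact: nns_iter.
exact: nnw_source.
Qed.

Lemma visits_le f h : nns f -> nns h -> (forall e x, f e x <= h e x) ->
  visits f <= visits h.
Proof.
move=> nf nh fh; apply: lee_nneseries => [k _ _|k _]; first exact: src_ge0.
apply: wsum_le => //; try exact: nns_iter; first exact: nnw_source.
exact: iter_step_le.
Qed.

Lemma mf_visits_at e :
  measure_functional (T := measurableTypeR R) (fun phi => visits (at_edge e phi)).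
Proof.
split.
(* Here [phi] may fail to be measurable, so [nns_iter] does not apply; nonnegativity comes from
   comparison with the iterates of the zero function. *)
- move=> phi phi0; apply: nneseries_ge0 => k _ _; apply: wsum_ge0 => [|e' x].
    exact: nnw_source.
  have : 0 <= iter k step (fun _ _ => 0) e' x.
    elim: k e' x => //= k ih e' x; rewrite /step; case: ifP => // _.
    by apply: sume_ge0 => e'' _; rewrite mule_ge0// lee_fin; case: nnw_turn.
  move/le_trans; apply; apply: iter_step_le => e'' y.
  by rewrite /at_edge; case: ifP.
- move=> phi c nphi c0; rewrite -[RHS](visitsZ (nns_at e nphi) c0).
  congr visits; apply/funext => e'; apply/funext => x; rewrite /at_edge.
  by case: ifP; rewrite ?mule0.
- move=> phi nphi; rewrite -[RHS](visits_series (fun n => nns_at e (nphi n))).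
  congr visits; apply/funext => e'; apply/funext => x; rewrite /at_edge.
  by case: ifP => // _; rewrite eseries0.
Qed.

Lemma at_edge_sum f : f = (fun e x => \sum_i at_edge i (f i) e x).
Proof.
apply/funext => e; apply/funext => x; rewrite (bigD1 e)//= big1 ?adde0.
  by rewrite /at_edge eqxx.
by move=> i; rewrite /at_edge eq_sym => /negPf ->.
Qed.

Lemma visits_sum_at f : nns f -> visits f = \sum_e visits (at_edge e (f e)).
Proof.
move=> nf; rewrite {1}(at_edge_sum f).
have h (s : seq A) : nns (fun e x => \sum_(i <- s) at_edge i (f i) e x) /\
    visits (fun e x => \sum_(i <- s) at_edge i (f i) e x) =
    \sum_(i <- s) visits (at_edge i (f i)).
  split; first by move=> e; apply: nnmeas_sum => i; exact: nns_at.
  elim: s => [|a s ih].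
    rewrite big_nil.
    under [X in visits X]eq_fun do under eq_fun do rewrite big_nil.
    have n0 : nns (fun _ _ => 0) by move=> e; exact: nnmeas_cst.
    have z := visitsZ n0 (lexx 0%R); rewrite [RHS]mul0e in z; rewrite -[RHS]z.
    by congr visits; apply/funext => e; apply/funext => x; rewrite mul0e.
  rewrite big_cons -ih -visitsD; [|exact: nns_at|].
    by congr visits; apply/funext => e; apply/funext => x; rewrite big_cons.
  by move=> e; apply: nnmeas_sum => i; exact: nns_at.
by case: (h (index_enum A)).
Qed.

Hypothesis intg : forall e, \int[mu]_x (g e x)%:E < +oo.

Lemma visits_density : exists m : A -> R -> R,
  nnw m /\ forall f, nns f -> visits f = wsum m f.
Proof.
have n1 : nnmeas (fun _ : R => 1 : \bar R).
  by split => [|x]; [exact: measurable_cst|exact: lee01].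
have H e : exists m : R -> R, [/\ measurable_fun setT m, forall x, (0 <= m x)%R &
    forall phi, nnmeas phi ->
      visits (at_edge e phi) = \int[mu]_x (phi x * (m x)%:E)].
  have [||m [mm m0 mE]] := mf_density (mu := mu) (mf_visits_at e); last first.
  - by exists m; split => // phi nphi; exact: mE.
  - move=> B mB muB0; apply/eqP; rewrite eq_le visits_ge0 ?andbT; last first.
      by apply: nns_at; exact: nnmeas_indic.
    have nB : nnmeas (fun x : R => (\1_B x)%:E : \bar R) by exact: nnmeas_indic.
    apply: le_trans (visits_le_wsum (nns_at e nB)) _; rewrite wsum_at//.
    rewrite integral_indicM null_set_integral//; apply: measurable_funTS.
    by apply/measurable_EFinP; case: ng => mg _; exact: mg.
  - apply: le_lt_trans (visits_le_wsum (nns_at e n1)) _.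
    rewrite wsum_at//; apply: le_lt_trans (intg e).
    by under eq_integral => x _ do rewrite mul1e.
pose m e := sval (cid (H e)).
have mP e := svalP (cid (H e)).
exists m; split.
  by split => [e|e x]; have [mm m0 _] := mP e; [exact: mm|exact: m0].
move=> f nf; rewrite visits_sum_at//; apply: eq_bigr => e _.
by case: (mP e) => _ _; exact.
Qed.

Lemma wsum_ae_eq w f h : nnw w -> nns f -> nns h ->
  (forall e, {ae mu, forall x, (0 < w e x)%R -> f e x = h e x}) ->
  wsum w f = wsum w h.
Proof.
move=> nw nf nh fh; apply: eq_bigr => e _.
have nwe := nnmeas_w e nw.
have [mf f0] := nnmeasM (nf e) nwe; have [mh h0] := nnmeasM (nh e) nwe.
apply: ge0_ae_eq_integral => //.
apply: ae_mono (fh e) => x fhx _.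
have [_ w0] := nw; have [->|wx] := eqVneq (w e x) 0%R; first by rewrite !mule0.
by rewrite fhx// lt_neqAle eq_sym wx w0.
Qed.

Lemma wsum_eq0 w f : nnw w -> nns f -> wsum w f = 0 ->
  forall e, {ae mu, forall x, (0 < w e x)%R -> f e x = 0}.
Proof.
move=> nw nf wf0 e; have nfw i := nnmeasM (nf i) (nnmeas_w i nw).
have [_ w0] := nw; have ife : \int[mu]_x (f e x * (w e x)%:E) = 0.
  apply/eqP; rewrite eq_le integral_ge0 ?andbT; last by move=> x _; case: (nfw e).
  rewrite -wf0 /wsum (bigD1 e)//= leeDl// sume_ge0// => i _.
  by apply: integral_ge0 => x _; case: (nfw i).
have fw0 := ae_leb_eq0 (nfw e) ife.
apply: (@ae_mono _ (fun x => f e x * (w e x)%:E = 0) _ _ fw0) => x /eqP.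
by rewrite mule_eq0 eqe => /orP[/eqP//|/eqP ->]; rewrite ltxx.
Qed.

(** The visits have density at most [g], but only almost everywhere, so [k] is the positive part of
    [g - m] and the splitting of [g] is stated for integrals. Invariance of [k] is the difference of
    [wsum_step] and [visits_rec]: both contain the same source term, and it cancels. *)
Lemma visits_residual : exists m k : A -> R -> R, [/\ nnw m, nnw k,
  forall f, nns f -> visits f = wsum m f,
  forall f, nns f -> wsum g f = wsum m f + wsum k f &
  (forall e x, (k e x <= g e x)%R) /\
  forall f, nns f -> wsum g f < +oo -> wsum k f = wsum k (step f)].
Proof.
have [m [nm visE]] := visits_density.
have [mm m0] := nm; have [mg g0] := ng.
have le e : {ae mu, forall x, (m e x <= g e x)%R}.
  apply: ae_le_integral; [exact: mm|exact: mg|exact: m0|exact: g0|exact: intg|].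
  move=> B mB; have nB : nnmeas (fun x : R => (\1_B x)%:E : \bar R).
    exact: nnmeas_indic.
  have := visits_le_wsum (nns_at e nB); rewrite visE; last exact: nns_at.
  by rewrite !wsum_at// !integral_indicM.
pose k e x : R := (Num.max (g e x - m e x) 0)%R.
have nk : nnw k.
  split=> [e|e x]; last by rewrite le_max lexx orbT.
  by apply: measurable_maxr => //; exact: measurable_funB.
have kg e x : (k e x <= g e x)%R by rewrite ge_max g0 andbT gerBl.
have gmk f : nns f -> wsum g f = wsum m f + wsum k f; last first.
  exists m, k; split => //; split => // f nf gf.
  have mf : wsum m f \is a fin_num.
    rewrite ge0_fin_numE; first by rewrite -visE// (le_lt_trans (visits_le_wsum nf)).
    by apply: wsum_ge0 => // e x; case: (nf e).
  have sf := nns_step nf.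
  have := wsum_step nf; rewrite !gmk// addeA -visE// -(visE _ sf) -visits_rec//.
  rewrite visE// => /(congr1 (fun z => z - wsum m f)).
  by rewrite ![_ + wsum k _]addeC !addeK.
move=> nf; rewrite -big_split/=; apply: eq_bigr => e _.
have [mf1 f1] := nnmeasM (nf e) (nnmeas_w e nm).
have [mf2 f2] := nnmeasM (nf e) (nnmeas_w e nk).
have [mf3 f3] := nnmeasM (nf e) (nnmeas_w e ng).
rewrite -ge0_integralD//; apply: ge0_ae_eq_integral => //.
- exact: emeasurable_funD.
- by move=> x _; rewrite adde_ge0.
- apply: ae_mono (le e) => x mgx _.
  rewrite -ge0_muleDr ?lee_fin//; last by case: nk.
  by rewrite -EFinD /k (max_idPl _) ?subr_ge0// addrC subrK.
Qed.

Variables (C : R).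
Hypothesis inH_bnd : forall x, inH x -> (0 <= x <= C)%R.
Hypothesis T_ge : forall e x, inH x -> (x <= T e x)%R.
Hypothesis g_inH : forall e x, ~~ inH x -> g e x = 0%R.

(** * The residual flow: no exits, no delays, a circulation *)

Section residual.
Variable k : A -> R -> R.
Hypotheses (nk : nnw k) (kg : forall e x, (k e x <= g e x)%R).
Hypothesis k_step : forall f, nns f -> wsum g f < +oo ->
  wsum k f = wsum k (step f).

(** The probability of entering a further edge within the horizon, kept real-valued so that [1 - q]
    can serve as a test function. *)
Let q e x : R := if inH (T e x) then
  (\sum_(e' | tl e' == hd e) p e' (T e x))%R else 0%R.

Let q0 e x : (0 <= q e x)%R.
Proof. by rewrite /q; case: ifP => // _; apply: sumr_ge0 => e' _; case: nnw_turn. Qed.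

Let q1 e x : (q e x <= 1)%R.
Proof.
rewrite /q; case: ifP => _; last exact: ler01.
by apply: le_trans (turn_le1 (hd e) (T e x)); rewrite lerDl leave_ge0.
Qed.

Let mq e : measurable_fun setT (q e).
Proof.
have [mp _] := nnw_turn; apply: measurable_fun_ifT; last exact: measurable_cst.
  exact: measurableT_comp.
under eq_fun do rewrite big_mkcond/=; apply: measurable_sum => e'.
case: (_ == _); last exact: measurable_cst.
by apply: measurableT_comp => //; exact: mp.
Qed.

Let nn1 : nns (fun _ _ => 1).
Proof. by move=> e; split => [|x]; [exact: measurable_cst|exact: lee01]. Qed.

Let step1 : step (fun _ _ => 1) = (fun e x => (q e x)%:E).
Proof.
apply/funext => e; apply/funext => x; rewrite /step /q; case: ifP => // _.
by rewrite /onward -sumEFin; apply: eq_bigr => e' _; rewrite mule1.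
Qed.

Let fin1 : wsum g (fun _ _ => 1) < +oo.
Proof.
apply: lte_sum_pinfty => e _.
by under eq_integral => x _ do rewrite mul1e.
Qed.

Let kfin f : nns f -> wsum g f < +oo -> wsum k f \is a fin_num.
Proof.
move=> nf ff; rewrite ge0_fin_numE; last first.
  by apply: wsum_ge0 => // e x; case: (nf e).
apply: le_lt_trans ff; apply: lee_sum => e _.
have [m1 h1] := nnmeasM (nf e) (nnmeas_w e nk).
have [m2 h2] := nnmeasM (nf e) (nnmeas_w e ng).
apply: ge0_le_integral => // x _.
by rewrite lee_wpmul2l ?lee_fin//; case: (nf e).
Qed.

Let nnsr (u : A -> R -> R) : (forall e, measurable_fun setT (u e)) ->
  (forall e x, (0 <= u e x)%R) -> nns (fun e x => (u e x)%:E).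
Proof.
move=> mu_ u0 e; split; [exact/measurable_EFinP|].
by move=> x; rewrite lee_fin.
Qed.

(** Otherwise [step] would lose a part of [k]. *)
Lemma residual_no_exit e : {ae mu, forall x, (0 < k e x)%R -> q e x = 1%R}.
Proof.
pose u e x : R := (1 - q e x)%R.
have mu_ i : measurable_fun setT (u i) by exact: measurable_funB.
have u0 i x : (0 <= u i x)%R by rewrite subr_ge0.
have nu := nnsr mu_ u0; have nq := nnsr mq q0.
have K1 : wsum k (fun _ _ => 1) =
    wsum k (fun e x => (q e x)%:E) + wsum k (fun e x => (u e x)%:E).
  rewrite -wsumD//; congr wsum; apply/funext => i; apply/funext => x.
  by rewrite -EFinD /u addrC subrK.
have Kq : wsum k (fun e x => (q e x)%:E) \is a fin_num.
  by rewrite -step1 -k_step//; exact: kfin.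
have Ku : wsum k (fun e x => (u e x)%:E) = 0.
  by apply: (adde_fixed Kq); rewrite -K1 -step1; exact: k_step.
apply: ae_mono (wsum_eq0 nk nu Ku e) => x h /h/eqP.
by rewrite eqe subr_eq0 => /eqP.
Qed.


Lemma residual_in e x : (0 < k e x)%R -> inH x.
Proof.
by move=> kx; apply: contraLR kx => /(g_inH e) gx; rewrite -leNgt -gx.
Qed.

(** The mean time at which [k] enters the edges equals the mean time at which
    [step] makes it leave them. *)
Lemma residual_no_delay e : {ae mu, forall x, (0 < k e x)%R -> T e x = x}.
Proof.
(* The entering time, cut off outside the horizon to make it a bounded nonnegative test function;
   boundedness makes its integral against [g] finite. *)
pose X (e : A) x : R := if inH x then x else 0%R.
have mX i : measurable_fun setT (X i).
  by apply: measurable_fun_ifT => //; exact: measurable_cst.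
have X0 i x : (0 <= X i x)%R.
  by rewrite /X; case: ifPn => // /inH_bnd/andP[].
have nX := nnsr mX X0.
have Xfin : wsum g (fun i x => (X i x)%:E) < +oo.
  have C0 : (0 <= Num.max C 0)%R by rewrite le_max lexx orbT.
  apply: (@le_lt_trans _ _ ((Num.max C 0)%:E * wsum g (fun _ _ => 1))).
    rewrite -wsumZ//; apply: wsum_le => //.
      by move=> i; apply: nnmeasM => //; exact: nnmeas_cst.
    move=> i x; rewrite mule1 lee_fin le_max /X.
    by case: ifPn => [/inH_bnd/andP[_ ->]//|_]; rewrite lexx orbT.
  by rewrite lte_mul_pinfty// ge0_fin_numE.
pose Y i x : R := (q i x * (if inH (T i x) then T i x else 0))%R.
have mY i : measurable_fun setT (Y i).
  by apply: measurable_funM => //; apply: (measurableT_comp (mX i)).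
have Y0 i x : (0 <= Y i x)%R by rewrite mulr_ge0//; exact: (X0 i).
have stepX : step (fun i x => (X i x)%:E) = (fun i x => (Y i x)%:E).
  apply/funext => i; apply/funext => x; rewrite /step /Y /q.
  case: ifP => Tx; last by rewrite mul0r.
  rewrite EFinM -sumEFin ge0_sume_distrl => [|e' _]; last first.
    by rewrite lee_fin; case: nnw_turn.
  by apply: eq_bigr => e' _; rewrite /X Tx.
pose u i x : R := (Num.max (Y i x - X i x) 0)%R.
have mu_ i : measurable_fun setT (u i).
  by apply: measurable_maxr => //; exact: measurable_funB.
have u0 i x : (0 <= u i x)%R by rewrite le_max lexx orbT.
have nY := nnsr mY Y0; have nu := nnsr mu_ u0.
(* Almost everywhere where [k] is positive, [q = 1], so [Y - X] is the delay [T i x - x],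
   nonnegative by [T_ge]. Taking the positive part in [u] only makes it a test function
   everywhere. *)
have YX : wsum k (fun i x => (Y i x)%:E) =
    wsum k (fun i x => (X i x)%:E) + wsum k (fun i x => (u i x)%:E).
  rewrite -wsumD//; apply: wsum_ae_eq => //.
    by move=> i; exact: nnmeasD.
  move=> i; apply: ae_mono (residual_no_exit i) => x qx kx.
  have /qx := kx; rewrite /u /Y /X /q (residual_in kx).
  case: ifP => [Tx ->|_ /esym/eqP]; last by rewrite oner_eq0.
  rewrite -EFinD mul1r (max_idPl _) ?subr_ge0 ?T_ge ?(residual_in kx)//.
  by rewrite addrC subrK.
have Ku : wsum k (fun i x => (u i x)%:E) = 0.
  have KX : wsum k (fun i x => (X i x)%:E) \is a fin_num by exact: kfin.
  by apply: (adde_fixed KX); rewrite -YX -stepX; apply/esym; exact: k_step.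
apply: ae_mono (ae_and (wsum_eq0 nk nu Ku e) (residual_no_exit e)).
move=> x [ux qx] kx; have /qx := kx; have := ux kx.
rewrite /u /X /Y /q (residual_in kx).
case: ifP => [Tx /eqP + q1'|_ _ /esym/eqP]; last by rewrite oner_eq0.
rewrite q1' mul1r eqe => /eqP m0; apply/eqP.
rewrite eq_le T_ge ?(residual_in kx)// andbT -subr_le0.
by rewrite -m0 le_max lexx.
Qed.

(** Without exits and delays, [step] turns the indicator of [B] on the edges leaving [v] into the
    same indicator on the edges entering [v]. Invariance of [k] then equates the two integrals over
    every [B]. *)
Lemma residual_circulation v : {ae mu, forall x,
  (\sum_(e | tl e == v) k e x = \sum_(e | hd e == v) k e x)%R}.
Proof.
have [mk k0] := nk.
pose out x : R := (\sum_(e | tl e == v) k e x)%R.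
pose inn x : R := (\sum_(e | hd e == v) k e x)%R.
have msum (P : pred A) : measurable_fun setT (fun x => \sum_(e | P e) k e x)%R.
  under eq_fun do rewrite big_mkcond/=; apply: measurable_sum => e.
  by case: (P e) => //; exact: mk.
have sumw (P : pred A) (B : set R) : measurable B ->
    \int[mu]_(x in B) (\sum_(e | P e) k e x)%:E =
    wsum k (fun e x => if P e then (\1_B x)%:E else 0).
  move=> mB; rewrite -integral_indicM /wsum.
  have nB : nnmeas (fun x : R => (\1_B x)%:E : \bar R) by exact: nnmeas_indic.
  rewrite -ge0_integral_sum//; last 2 first.
  - move=> e; case: (P e); first by case: (nnmeasM nB (nnmeas_w e nk)).
    by under eq_fun do rewrite mul0e; exact: measurable_cst.
  - by move=> e x _; rewrite mule_ge0// ?lee_fin//; case: ifP; rewrite ?lee_fin.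
  apply: eq_integral => x _; rewrite -sumEFin ge0_sume_distrr => [|e _]; last first.
    by rewrite lee_fin.
  by rewrite big_mkcond/=; apply: eq_bigr => e _; case: ifP; rewrite ?mul0e.
have nP (P : pred A) (B : set R) : measurable B ->
    nns (fun e x => if P e then (\1_B x)%:E else 0).
  by move=> mB e; case: (P e); [exact: nnmeas_indic|exact: nnmeas_cst].
have fP (P : pred A) (B : set R) : measurable B ->
    wsum g (fun e x => if P e then (\1_B x)%:E else 0) < +oo.
  move=> mB; apply: le_lt_trans fin1; apply: wsum_le => //; first exact: nP.
  move=> e x; case: (P e); last exact: lee01.
  by rewrite lee_fin indicE; case: (_ \in _); rewrite ?ler01.
have io B : measurable B ->
    \int[mu]_(x in B) (out x)%:E = \int[mu]_(x in B) (inn x)%:E.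
  move=> mB; rewrite !sumw// k_step//; [|exact: nP|exact: fP].
  apply: wsum_ae_eq => //; [by apply: nns_step; exact: nP|exact: nP|].
  move=> e; apply: ae_mono (ae_and (residual_no_exit e) (residual_no_delay e)).
  move=> x [qx Tx] kx; rewrite /step (Tx kx) (residual_in kx) /onward.
  case: eqP => [hv|hv].
    rewrite -[RHS]mul1e -(qx kx) /q (Tx kx) (residual_in kx) -sumEFin.
    rewrite ge0_sume_distrl => [|e' _]; last by rewrite lee_fin; case: nnw_turn.
    by apply: eq_bigr => e' /eqP te; rewrite te hv eqxx.
  by apply: big1 => e' /eqP te; rewrite te; case: eqP => // _; rewrite mule0.
have io2 : ae_eq mu setT (EFin \o out) (EFin \o inn).
  apply: integral_ae_eq => //.
  - apply/integrableP; split; first by apply/measurable_EFinP; exact: msum.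
    under eq_integral => x _ do rewrite /= ger0_norm ?sumr_ge0//.
    rewrite (sumw (fun e => tl e == v) setT)//.
    have := kfin (nP (fun e => tl e == v) _ measurableT) (fP _ _ measurableT).
    by rewrite ge0_fin_numE//; apply: wsum_ge0 => // e x; case: ifP; rewrite ?lee_fin.
  - by apply/measurable_EFinP; exact: msum.
  - by move=> B _ mB; exact: io.
by apply: ae_mono io2 => x /(_ I)[].
Qed.

End residual.

(** * Crediting the particles to finite walks *)

Variable canon : V -> option (seq A).
Hypothesis canon_ex : forall e, {ae mu, forall x, (0 < g e x)%R ->
  ~~ inH (T e x) -> canon (hd e) != None}.

(** The share of the particles entering [e] at time [x] that is credited to the
    walk [e :: u].  A particle running past the horizon on [e] is credited to
    the fixed continuation [canon (hd e)] of its past. *)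
Fixpoint tail_weight (e : A) (u : seq A) (x : R) : R :=
  if inH (T e x) then
    if u is e' :: u' then
      if tl e' == hd e then (p e' (T e x) * tail_weight e' u' (T e x))%R else 0%R
    else leave (hd e) (T e x)
  else (Some u == canon (hd e))%:R.

(** [f] summed over the edges entered within the horizon along [e :: u]. *)
Fixpoint tail_count f (e : A) (u : seq A) (x : R) : \bar R :=
  f e x + if inH (T e x) then
    if u is e' :: u' then tail_count f e' u' (T e x) else 0
  else 0.

(** Sums over walks run over all words of a given length; adjacency is left to the weights, not to
    the index set. *)
Fixpoint words n : seq (seq A) :=
  if n is n'.+1 then [seq e :: u | e <- enum A, u <- words n'] else [:: [::]].

Lemma mem_words n w : (w \in words n) = (size w == n).
Proof.
elim: n w => [|n ih] [|e w]//=; last first.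
  rewrite eqSS -ih; apply/allpairsP/idP => [[[a u]/= [_ wu [_ ->]]]//|wn].
  by exists (e, w); rewrite mem_enum.
by apply/negbTE/negP => /allpairsP[[a u]/= []].
Qed.

Lemma uniq_words n : uniq (words n).
Proof.
elim: n => //= n ih; apply: allpairs_uniq => //; first exact: enum_uniq.
by move=> [a u] [a' u'] _ _ /= [-> ->].
Qed.

Local Notation Q := tail_weight.
Local Notation N := tail_count.

Lemma tail_weight_ge0 e u x : (0 <= Q e u x)%R.
Proof.
elim: u e x => [|a u ih] e x /=; case: ifP => // _; first exact: leave_ge0.
by case: ifP => // _; rewrite mulr_ge0//; case: nnw_turn.
Qed.

Lemma measurable_tail_weight e u : measurable_fun setT (Q e u).
Proof.
have [mp _] := nnw_turn.
elim: u e => [|a u ih] e /=; apply: measurable_fun_ifT => //;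
  try exact: measurable_cst; try exact: measurableT_comp.
  by apply: (measurableT_comp (measurable_leave _)).
case: (_ == _); last exact: measurable_cst.
apply: measurable_funM; first exact: (measurableT_comp (mp a)).
exact: (measurableT_comp (ih a)).
Qed.

Lemma tail_count_ge0 f e u x : nns f -> 0 <= N f e u x.
Proof.
move=> nf; elim: u e x => [|a u ih] e x /=; rewrite adde_ge0//; try by case: (nf e).
  by case: ifP.
by case: ifP.
Qed.

Lemma nnmeas_tail_count f e u : nns f -> nnmeas (N f e u).
Proof.
move=> nf; split; last by move=> x; exact: tail_count_ge0.
elim: u e => [|a u ih] e /=; apply: emeasurable_funD; try by case: (nf e).
  by under eq_fun do rewrite if_same; exact: measurable_cst.
apply: measurable_fun_ifT; [exact: measurableT_comp| |exact: measurable_cst].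
exact: (measurableT_comp (ih a)).
Qed.

(** For a particle entering [e] at [x]: the probability that its credited walk has [n] further
    edges, and next the expected count of [f] on that event. [ending_after] is the part of this
    probability that is decided at the end of [e], by stopping or by passing the horizon. *)
Definition tail_mass n : A -> R -> \bar R :=
  fun e x => \sum_(u <- words n) (Q e u x)%:E.
Definition visit_mass n f : A -> R -> \bar R :=
  fun e x => \sum_(u <- words n) (Q e u x)%:E * N f e u x.
Definition ending_after n : A -> R -> \bar R := fun e x =>
  (if inH (T e x) then (n == 0%N)%:R * leave (hd e) (T e x)
   else if canon (hd e) is Some c then (size c == n)%:R else 0)%R%:E.

Lemma nnmeas_tail_weight e u : nnmeas (fun x => (Q e u x)%:E).
Proof.
split; first by apply/measurable_EFinP; exact: measurable_tail_weight.
by move=> x; rewrite lee_fin tail_weight_ge0.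
Qed.

Lemma nns_tail_mass n : nns (tail_mass n).
Proof. by move=> e; apply: nnmeas_sum => u; exact: nnmeas_tail_weight. Qed.

Lemma nns_visit_mass n f : nns f -> nns (visit_mass n f).
Proof.
move=> nf e; apply: nnmeas_sum => u; apply: nnmeasM.
  exact: nnmeas_tail_weight.
exact: nnmeas_tail_count.
Qed.

Lemma nns_ending_after n : nns (ending_after n).
Proof.
move=> e; rewrite /ending_after; split; last first.
  move=> x; rewrite lee_fin; case: ifP => _; first by rewrite mulr_ge0// leave_ge0.
  by case: (canon _).
apply/measurable_EFinP; apply: measurable_fun_ifT; first exact: measurableT_comp.
  apply: measurable_funM => //.
  exact: (measurableT_comp (measurable_leave _)).
by case: (canon _) => *; exact: measurable_cst.
Qed.

Lemma sum_words_eq n (o : option (seq A)) :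
  \sum_(u <- words n) (Some u == o)%:R%:E =
  (if o is Some c then (size c == n)%:R else 0)%R%:E :> \bar R.
Proof.
case: o => [c|]; last by rewrite big1.
rewrite -mem_words; have [cn|cn] := boolP (c \in words n).
  rewrite (bigD1_seq c)//=; last exact: uniq_words.
  rewrite eqxx big1 ?adde0// => u /negPf uc.
  by rewrite (_ : (Some u == Some c) = false)//; apply/eqP => -[/eqP]; rewrite uc.
rewrite big_seq big1// => u un; case: eqP => // -[uc].
by rewrite -uc un in cn.
Qed.

Lemma tail_weight_stranded e u x : inH (T e x) = false ->
  Q e u x = (Some u == canon (hd e))%:R.
Proof. by case: u => [|a u] /= ->. Qed.

Lemma tail_mass0 : tail_mass 0%N = ending_after 0%N.
Proof.
apply/funext => e; apply/funext => x; rewrite /tail_mass /ending_after.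
case: ifP => Tx; first by rewrite big_seq1/= Tx mul1r.
rewrite -sum_words_eq; apply: eq_bigr => u _.
by rewrite tail_weight_stranded.
Qed.

(** First-step analysis: either the rest of the walk is settled at the end of [e], or a next edge is
    drawn and [n] edges remain after it. *)
Lemma tail_massS n : tail_mass n.+1 = (fun e x => ending_after n.+1 e x + step (tail_mass n) e x).
Proof.
have [_ p0] := nnw_turn.
apply/funext => e; apply/funext => x; rewrite /tail_mass /ending_after /step.
case: ifP => Tx; last first.
  rewrite adde0 -sum_words_eq; apply: eq_bigr => u _.
  by rewrite tail_weight_stranded.
rewrite big_allpairs_dep/= big_enum/= mul0r add0e /onward [RHS]big_mkcond/=.
apply: eq_bigr => a _; under eq_bigr do rewrite Tx.
case: eqP => _; last by rewrite big1.
rewrite ge0_sume_distrr; last by move=> u _; rewrite lee_fin tail_weight_ge0.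
by apply: eq_bigr => u _.
Qed.

Lemma visit_mass0 f : visit_mass 0%N f = (fun e x => f e x * tail_mass 0%N e x).
Proof.
apply/funext => e; apply/funext => x.
by rewrite /visit_mass /tail_mass !big_seq1/= if_same adde0 muleC.
Qed.

(** The visit to [e] itself is counted once for every continuation, whence the factor [tail_mass];
    the later visits are those counted from the next edge. *)
Lemma visit_massS n f : nns f ->
  visit_mass n.+1 f = (fun e x => f e x * tail_mass n.+1 e x + step (visit_mass n f) e x).
Proof.
move=> nf; have [_ p0] := nnw_turn.
have f0 e x : 0 <= f e x by case: (nf e).
have w0 e u x : 0 <= (Q e u x)%:E by rewrite lee_fin tail_weight_ge0.
apply/funext => e; apply/funext => x.
rewrite /visit_mass /tail_mass ge0_sume_distrr//.
have -> : \sum_(u <- words n.+1) (Q e u x)%:E * N f e u x =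
    \sum_(u <- words n.+1) f e x * (Q e u x)%:E +
    \sum_(u <- words n.+1) (Q e u x)%:E *
      (if inH (T e x) then
        if u is e' :: u' then N f e' u' (T e x) else 0 else 0).
  rewrite -big_split/=; apply: eq_bigr => u _.
  rewrite [f e x * _]muleC -ge0_muleDr//; first by case: u.
  by case: u => [|a u]; case: ifP => // _; exact: tail_count_ge0.
congr (_ + _); rewrite /step; case: ifP => Tx; last first.
  by rewrite big1// => u _; rewrite mule0.
rewrite big_allpairs_dep/= big_enum/= /onward [RHS]big_mkcond/=.
apply: eq_bigr => a _; under eq_bigr do rewrite Tx.
case: eqP => _; last by rewrite big1// => u _; rewrite mul0e.
rewrite ge0_sume_distrr.
  by apply: eq_bigr => u _; rewrite EFinM muleA.
by move=> u _; rewrite mule_ge0// tail_count_ge0.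
Qed.

Definition tail_mass_upto n : A -> R -> \bar R :=
  fun e x => \sum_(0 <= m < n) tail_mass m e x.
Definition ending_upto n : A -> R -> \bar R :=
  fun e x => \sum_(0 <= m < n) ending_after m e x.

Lemma step_sum (f : nat -> A -> R -> \bar R) n : (forall m, nns (f m)) ->
  step (fun e x => \sum_(0 <= m < n) f m e x) =
  (fun e x => \sum_(0 <= m < n) step (f m) e x).
Proof.
move=> nf; elim: n => [|n ih].
  apply/funext => e; apply/funext => x; rewrite big_nil /step.
  by case: ifP => // _; apply: big1 => a _; rewrite big_nil mule0.
under [in LHS]eq_fun do under eq_fun do rewrite big_nat_recr//=.
rewrite stepD// ?ih; last by move=> e; apply: nnmeas_sum => m; exact: nf.
by apply/funext => e; apply/funext => x; rewrite big_nat_recr.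
Qed.

Lemma tail_mass_uptoS n : tail_mass_upto n.+1 =
  (fun e x => ending_upto n.+1 e x + step (tail_mass_upto n) e x).
Proof.
rewrite /tail_mass_upto step_sum; last exact: nns_tail_mass.
apply/funext => e; apply/funext => x; rewrite /ending_upto.
rewrite [LHS]big_nat_recl//= [X in _ = X + _]big_nat_recl//= -addeA.
rewrite -big_split/= tail_mass0.
by congr (_ + _); apply: eq_bigr => m _; rewrite tail_massS.
Qed.

Definition ending e x : R :=
  if inH (T e x) then leave (hd e) (T e x) else (canon (hd e) != None)%:R.

Lemma nneseries_pred1 (k : nat) (c : R) : (0 <= c)%R ->
  \sum_(n <oo) ((n == k)%:R * c)%R%:E = c%:E.
Proof.
move=> c0; rewrite (nneseriesD1 (n := k))//; last first.
  by move=> n _; rewrite lee_fin mulr_ge0.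
rewrite eqxx mul1r eseries0 ?adde0// => n _ /= /negPf ->.
by rewrite mul0r.
Qed.

Lemma ending_after_series e x : \sum_(n <oo) ending_after n e x = (ending e x)%:E.
Proof.
rewrite /ending_after /ending; case: ifP => _.
  exact: nneseries_pred1 (leave_ge0 _ _).
case: (canon _) => [c|] /=; last by rewrite eseries0.
rewrite -(nneseries_pred1 (size c) ler01).
by apply: eq_eseriesr => n _; rewrite mulr1 eq_sym.
Qed.

(** By induction on the length bound, since stopping and the possible next edges have total
    probability at most 1. *)
Lemma tail_mass_upto_le1 n e x : tail_mass_upto n e x <= 1.
Proof.
elim: n e x => [|n ih] e x; first by rewrite /tail_mass_upto big_nil lee01.
rewrite tail_mass_uptoS.
have : ending_upto n.+1 e x <= (ending e x)%:E.
  rewrite -ending_after_series; apply: nneseries_lim_ge => m _ _.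
  by case: (nns_ending_after m e).
rewrite /step /ending; case: ifP => _ h; last first.
  by rewrite adde0; apply: le_trans h _; rewrite lee_fin lern1 leq_b1.
apply: le_trans (leeD h (lexx _)) _.
apply: (@le_trans _ _ ((leave (hd e) (T e x))%:E +
    \sum_(a | tl a == hd e) (p a (T e x))%:E)).
  apply: leeD => //; apply: lee_sum => a _.
  by rewrite -[leRHS]mule1 lee_wpmul2l// lee_fin; case: nnw_turn.
by rewrite sumEFin -EFinD lee_fin addrC turn_le1.
Qed.

Definition total_tail_mass : A -> R -> \bar R := fun e x => \sum_(n <oo) tail_mass n e x.

Lemma nns_total_tail_mass : nns total_tail_mass.
Proof. exact: nns_series nns_tail_mass. Qed.

Lemma total_tail_mass_le1 e x : total_tail_mass e x <= 1.
Proof.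
apply: lime_le.
  by apply: is_cvg_nneseries => n _ _; case: (nns_tail_mass n e).
by apply: nearW => n; exact: tail_mass_upto_le1.
Qed.

Lemma total_tail_mass_rec :
  total_tail_mass = (fun e x => (ending e x)%:E + step total_tail_mass e x).
Proof.
have m0 n e x : 0 <= tail_mass n e x by case: (nns_tail_mass n e).
have sm0 n e x : 0 <= step (tail_mass n) e x by case: (nns_step (nns_tail_mass n) e).
have fi0 n e x : 0 <= ending_after n e x by case: (nns_ending_after n e).
rewrite [in RHS]/total_tail_mass step_series; last exact: nns_tail_mass.
apply/funext => e; apply/funext => x.
rewrite -ending_after_series [in RHS]nneseries_shift// [LHS]nneseries_shift//.
rewrite -addeA -nneseriesD// tail_mass0; congr (_ + _).
by apply: eq_eseriesr => n _; rewrite tail_massS.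
Qed.

Let visit_mass_upto_step f (n : nat) : nns f ->
  (fun e x => \sum_(0 <= m < n.+1) visit_mass m f e x) =
  (fun e x => f e x * tail_mass_upto n.+1 e x +
    step (fun e x => \sum_(0 <= m < n) visit_mass m f e x) e x).
Proof.
move=> nf; rewrite step_sum; last by move=> m; exact: nns_visit_mass.
apply/funext => e; apply/funext => x; rewrite /tail_mass_upto.
rewrite ge0_sume_distrr; last by move=> m _; case: (nns_tail_mass m e).
rewrite [LHS]big_nat_recl//= [X in _ = X + _]big_nat_recl//= -addeA -big_split/=.
by rewrite visit_mass0; congr (_ + _); apply: eq_bigr => m _; rewrite visit_massS.
Qed.

Definition weighted f : A -> R -> \bar R := fun e x => f e x * total_tail_mass e x.

Lemma nns_weighted f : nns f -> nns (weighted f).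
Proof. by move=> nf e; apply: nnmeasM => //; exact: nns_total_tail_mass. Qed.

(** A tail of fewer than [n] further edges has visits only at positions below [n], and from each of
    them the short continuations have mass at most [total_tail_mass]. With the converse bound
    [iter_total_visit_mass], this exchanges the sum over lengths of walks with the sum over
    positions in them. *)
Let visit_masses_le f n e x : nns f ->
  \sum_(0 <= m < n) visit_mass m f e x <=
  \sum_(0 <= k < n) iter k step (weighted f) e x.
Proof.
move=> nf; have f0 i y : 0 <= f i y by case: (nf i).
elim: n e x => [|n ih] e x; first by rewrite !big_nil.
have -> := congr1 (fun F => F e x) (visit_mass_upto_step n nf).
rewrite big_nat_recl//=; apply: leeD.
  rewrite lee_wpmul2l//; apply: nneseries_lim_ge => m _ _.
  by case: (nns_tail_mass m e).
have -> : \sum_(0 <= i < n) step (iter i step (weighted f)) e x =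
    step (fun e x => \sum_(0 <= i < n) iter i step (weighted f) e x) e x.
  by rewrite step_sum// => m; exact: nns_iter (nns_weighted nf).
exact: step_le.
Qed.

Definition total_visit_mass f : A -> R -> \bar R :=
  fun e x => \sum_(n <oo) visit_mass n f e x.

Lemma total_visit_mass_rec f : nns f -> (forall e x, f e x <= 1) ->
  total_visit_mass f = (fun e x => weighted f e x + step (total_visit_mass f) e x).
Proof.
move=> nf f1; have nc n := nns_visit_mass n nf.
have c0 n e x : 0 <= visit_mass n f e x by case: (nc n e).
have f0 i y : 0 <= f i y by case: (nf i).
have fm0 n e x : 0 <= f e x * tail_mass n e x.
  by rewrite mule_ge0//; case: (nns_tail_mass n e).
have sc0 n e x : 0 <= step (visit_mass n f) e x by case: (nns_step (nc n) e).
rewrite [in RHS]/total_visit_mass step_series//.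
apply/funext => e; apply/funext => x.
have -> : weighted f e x = \sum_(n <oo) (f e x * tail_mass n e x).
  rewrite /weighted; have /fineK <- : f e x \is a fin_num.
    by rewrite ge0_fin_numE// (le_lt_trans (f1 e x))// ltry.
  by rewrite nneseriesZl// => n _; case: (nns_tail_mass n e).
rewrite [X in _ = X + _]nneseries_shift// [LHS]nneseries_shift//.
rewrite -addeA -nneseriesD// visit_mass0; congr (_ + _).
by apply: eq_eseriesr => n _; rewrite visit_massS.
Qed.

Lemma iter_total_visit_mass f n e x : nns f -> (forall e x, f e x <= 1) ->
  \sum_(0 <= k < n) iter k step (weighted f) e x <= total_visit_mass f e x.
Proof.
move=> nf f1; have nw := nns_weighted nf; elim: n e x => [|n ih] e x.
  rewrite big_nil; apply: nneseries_ge0 => m _ _; by case: (nns_visit_mass m nf e).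
rewrite total_visit_mass_rec// big_nat_recl//=; apply: leeD => //.
have -> : \sum_(0 <= i < n) step (iter i step (weighted f)) e x =
    step (fun e x => \sum_(0 <= i < n) iter i step (weighted f) e x) e x.
  by rewrite step_sum// => m; exact: nns_iter.
exact: step_le.
Qed.

(** The states where the probabilities of all continuations do not add up
    to [1]; almost none of the flow passes through them. *)
Let bad e x : R :=
  if inH (T e x) then ((b (hd e) (T e x) <= 0)%R)%:R else (canon (hd e) == None)%:R.

Let mdry v : measurable_fun setT (fun x => ((b v x <= 0)%R)%:R : R).
Proof.
rewrite (_ : (fun _ => _) = fun x => if (b v x <= 0)%R then 1%R else 0%R); last first.
  by apply/funext => x; case: ifP.
apply: measurable_fun_ifT; try exact: measurable_cst.
by apply: measurable_fun_ler; [exact: measurable_throughput|exact: measurable_cst].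
Qed.

Let nns_bad : nns (fun e x => (bad e x)%:E).
Proof.
move=> e; split; last by move=> x; rewrite lee_fin /bad; case: ifP.
apply/measurable_EFinP; apply: measurable_fun_ifT; first exact: measurableT_comp.
  exact: (measurableT_comp (mdry _)).
exact: measurable_cst.
Qed.

(** Arrival at a node of zero throughput is excluded by [balance], tested on the indicator of such
    times: the left side is 0, hence so are the arrivals. Passing the horizon without a continuation
    is excluded by [canon_ex]. *)
Let wsum_bad : wsum g (fun e x => (bad e x)%:E) = 0.
Proof.
have [mg g0] := ng; apply: big1 => e _.
pose phi v x : \bar R := ((b v x <= 0)%R)%:R%:E.
have nphi v : nnmeas (phi v).
  by split => [|x]; [exact/measurable_EFinP|rewrite lee_fin].
have nG a : nnmeas (fun x => phi (hd e) (T a x) * (if inH (T a x) then g a x else 0%R)%:E).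
  apply: nnmeasM.
    have [m1 m2] := nphi (hd e); split => //; exact: measurableT_comp.
  split; last by move=> x; rewrite lee_fin; case: ifP.
  apply/measurable_EFinP; apply: measurable_fun_ifT => //.
  exact: measurableT_comp.
transitivity (\int[mu]_x (phi (hd e) (T e x) * (if inH (T e x) then g e x else 0%R)%:E)).
  have [m1 h1] := nG e.
  have [m2 h2] := nnmeasM (nns_bad e) (nnmeas_w e ng).
  apply: ge0_ae_eq_integral => //.
  apply: ae_mono (canon_ex e) => x hx _; rewrite /bad /phi.
  case: ifPn => Tx //; rewrite mule0.
  have [->|gx] := eqVneq (g e x) 0%R; first by rewrite mule0.
  have /hx : (0 < g e x)%R by rewrite lt_neqAle eq_sym gx g0.
  by move=> /(_ Tx)/negPf ->; rewrite mul0e.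
apply/eqP; rewrite eq_le integral_ge0 ?andbT; last by move=> x _; case: (nG e).
have := balance (hd e) (nphi (hd e)).
rewrite integral0_eq; last first.
  move=> x _; rewrite /phi; case: ltP => [|bx]; first by rewrite mul0e.
  have /eqP -> : b (hd e) x == 0%R by rewrite eq_le bx throughput_ge0.
  by rewrite mule0.
move=> ->; rewrite (bigD1 e)//= -addeA leeDl// adde_ge0//.
  by apply: sume_ge0 => a _; apply: integral_ge0 => x _; case: (nG a).
apply: integral_ge0 => x _; by rewrite mule_ge0// /phi lee_fin.
Qed.

Let visits_bad k : wsum source (iter k step (fun e x => (bad e x)%:E)) = 0.
Proof.
apply/eqP; rewrite eq_le src_ge0// andbT -wsum_bad.
rewrite [leRHS](wsum_iter_step k.+1 nns_bad) big_nat_recr//= -addeA.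
rewrite addeCA leeDl// adde_ge0//.
  by apply: sume_ge0 => i _; exact: src_ge0.
by apply: wsum_ge0 => // e x; case: (nns_step (nns_iter k nns_bad) e).
Qed.

(** The probability of being credited to no finite walk. *)
Definition deficit e x : \bar R := 1 - total_tail_mass e x.

Lemma total_tail_mass_fin e x : total_tail_mass e x \is a fin_num.
Proof.
rewrite ge0_fin_numE; first by rewrite (le_lt_trans (total_tail_mass_le1 e x))// ltry.
by case: (nns_total_tail_mass e).
Qed.

Lemma nns_deficit : nns deficit.
Proof.
move=> e; split; last by move=> x; rewrite /deficit sube_ge0 ?total_tail_mass_le1// total_tail_mass_fin.
by apply: emeasurable_funB; [exact: measurable_cst|case: (nns_total_tail_mass e)].
Qed.

Lemma deficitE : (fun e x => total_tail_mass e x + deficit e x) = fun _ _ => 1.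
Proof.
apply/funext => e; apply/funext => x.
by rewrite /deficit addeC subeK// total_tail_mass_fin.
Qed.

(** What never ends only moves on, except at [bad] states. *)
Lemma deficit_step : deficit = (fun e x => step deficit e x + (bad e x)%:E).
Proof.
apply/funext => e; apply/funext => x.
have one : step (fun _ _ => 1) e x + (ending e x)%:E + (bad e x)%:E = 1.
  rewrite /step /ending /bad /onward; case: ifP => Tx; last first.
    by rewrite add0e -EFinD; case: (canon _) => [c|]; rewrite /= ?addr0 ?add0r.
  under eq_bigr do rewrite mule1.
  rewrite sumEFin -!EFinD; case: ltP => bx.
    by rewrite turn_leave ?addr0// gt_eqF.
  have /eqP b0 : b (hd e) (T e x) == 0%R by rewrite eq_le bx throughput_ge0.
  rewrite /leave b0 invr0 mulr0 addr0 big1 ?add0r// => a /eqP ta.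
  by rewrite /turn ta b0 invr0 mulr0.
have canc u v : total_tail_mass e x + u = total_tail_mass e x + v -> u = v.
  move/(congr1 (fun z => z - total_tail_mass e x)).
  by rewrite ![total_tail_mass e x + _]addeC !addeK// total_tail_mass_fin.
apply: canc.
have -> : total_tail_mass e x + deficit e x = 1 := congr1 (fun F => F e x) deficitE.
rewrite -[LHS]one -deficitE stepD; [|exact: nns_total_tail_mass|exact: nns_deficit].
rewrite [X in _ = X + _](congr1 (fun F => F e x) total_tail_mass_rec).
by rewrite -!addeA [step deficit e x + ((ending e x)%:E + _)]addeCA addeCA.
Qed.

(** The deficit is carried along from edge to edge, so a positive deficit at the start would be
    collected again at every later edge, against the finite number of visits. Formally,
    [visits (step deficit)] is finite and cancels, leaving no deficit at the source; the later
    positions follow by induction. *)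
Lemma visits_deficit : visits deficit = 0.
Proof.
have nd := nns_deficit.
have fin : visits (step deficit) \is a fin_num.
  have nn1 : nns (fun _ _ => 1).
    by move=> e; split => [|x]; [exact: measurable_cst|exact: lee01].
  have h : visits deficit < +oo.
    apply: le_lt_trans (visits_le_wsum nd) _.
    apply: (@le_lt_trans _ _ (wsum g (fun _ _ => 1))).
      apply: wsum_le => // e x.
      by rewrite -(congr1 (fun F => F e x) deficitE) leeDr//; case: (nns_total_tail_mass e).
    by apply: lte_sum_pinfty => e _; under eq_integral => x _ do rewrite mul1e.
  rewrite ge0_fin_numE; last exact/visits_ge0/nns_step.
  by apply: le_lt_trans h; rewrite (visits_rec nd) leeDr//; exact: (src_ge0 0).
have src0 : wsum source deficit = 0.
  apply: (adde_fixed fin); rewrite addeC -(visits_rec nd) [in LHS]deficit_step.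
  rewrite visitsD//; last exact: nns_step.
  by rewrite [X in _ + X]/visits eseries0 ?adde0.
rewrite /visits eseries0// => k _ _; elim: k => //= k ih.
have := ih; rewrite [in X in X -> _]deficit_step iter_stepD//; last exact: nns_step.
rewrite wsumD//; [|exact: nnw_source|exact/nns_iter/nns_step|exact: nns_iter].
by rewrite visits_bad adde0 -iterSr.
Qed.

Lemma wsum_sum_nat w (f : nat -> A -> R -> \bar R) n : nnw w ->
  (forall m, nns (f m)) ->
  wsum w (fun e x => \sum_(0 <= m < n) f m e x) = \sum_(0 <= m < n) wsum w (f m).
Proof.
move=> nw nf; elim: n => [|n ih].
  rewrite big_nil; apply: big1 => e _; apply: integral0_eq => x _.
  by rewrite big_nil mul0e.
rewrite big_nat_recr//= -ih -wsumD//; last first.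
  by move=> e; apply: nnmeas_sum => m; exact: nf.
by congr wsum; apply/funext => e; apply/funext => x; rewrite big_nat_recr.
Qed.

(** Sorting by the length of the credited walk loses no visits: by [visits_deficit], the factor
    [total_tail_mass] in [weighted] does not change them, and the two orders of summation bound each
    other through partial sums. *)
Lemma sum_visit_mass f : nns f -> (forall e x, f e x <= 1) ->
  \sum_(n <oo) wsum source (visit_mass n f) = visits f.
Proof.
move=> nf f1; have nw := nns_weighted nf; have ns := nnw_source.
have nc n := nns_visit_mass n nf.
have ni n := nns_iter n nw.
have f0 i y : 0 <= f i y by case: (nf i).
have d0 i y : 0 <= deficit i y by case: (nns_deficit i).
have -> : visits f = visits (weighted f).
  have nfd : nns (fun e x => f e x * deficit e x).
    by move=> e; apply: nnmeasM => //; exact: nns_deficit.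
  have fE : f = (fun e x => weighted f e x + f e x * deficit e x).
    apply/funext => e; apply/funext => x; rewrite /weighted -ge0_muleDr//.
      by have -> := congr1 (fun F => F e x) deficitE; rewrite mule1.
    by case: (nns_total_tail_mass e).
  rewrite [in LHS]fE visitsD//.
  suff -> : visits (fun e x => f e x * deficit e x) = 0 by rewrite adde0.
  apply/eqP; rewrite eq_le visits_ge0// andbT -visits_deficit.
  apply: visits_le => //; first exact: nns_deficit.
  by move=> e x; rewrite -[leRHS]mul1e lee_wpmul2r.
apply/eqP; rewrite eq_le; apply/andP; split.
  apply: lime_le.
    apply: is_cvg_nneseries => n _ _; apply: wsum_ge0 => // e x.
    by case: (nc n e).
  apply: nearW => n; rewrite -wsum_sum_nat//.
  apply: (@le_trans _ _ (wsum source (fun e x => \sum_(0 <= k < n)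
    iter k step (weighted f) e x))).
    apply: wsum_le => //.
    - by move=> e; apply: nnmeas_sum => m; exact: nc.
    - by move=> e; apply: nnmeas_sum => m; exact: ni.
    - by move=> e x; exact: visit_masses_le.
  rewrite wsum_sum_nat//; apply: nneseries_lim_ge => m _ _.
  exact: src_ge0.
rewrite -[leRHS](wsum_series ns nc).
apply: lime_le.
  by apply: is_cvg_nneseries => n _ _; exact: src_ge0.
apply: nearW => n; rewrite -wsum_sum_nat//; apply: wsum_le => //.
- by move=> e; apply: nnmeas_sum => m; exact: ni.
- exact: nns_series.
- by move=> e x; exact: iter_total_visit_mass.
Qed.

End Markov.

(** * Circulations as sums of simple cycles *)

Section CycleDecomposition.
Context {R : realType} {V : finType} (E : {set V * V}).
Local Notation A := (edge E).
Implicit Types (w c : seq A) (cs : seq (seq A)) (k : A -> R -> R).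

(** The heads are the tails rotated by one position. *)
Lemma cycle_perm c : is_cycle c ->
  perm_eq [seq tail e | e <- c] [seq Defs.head e | e <- c].
Proof.
case: c => [|e p] /existsP[v]; rewrite /walk_from_to//= => /andP[wp /andP[/eqP te /eqP hl]].
have -> : Defs.head e :: [seq Defs.head i | i <- p] =
    rcons [seq tail i | i <- p] (Defs.head (last e p)).
  elim: p e {te hl} wp => //= e' p ih e /andP[/eqP -> /ih ->].
  by [].
by rewrite hl -te perm_sym perm_rcons.
Qed.

Lemma simple_cycle_uniq c : is_simple_cycle c -> uniq c.
Proof. by case/andP => _; exact: map_uniq. Qed.

Lemma simple_cycle_size c : is_simple_cycle c -> (size c <= #|V|)%N.
Proof.
by case/andP => _ uc; rewrite -(size_map (@tail V E)) -(card_uniqP uc) max_card.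
Qed.

Definition cycle_seq : seq (seq A) := undup
  [seq c <- flatten [seq words n | n <- iota 0 (#|V|).+1] | is_simple_cycle c].

Lemma mem_cycle_seq c : (c \in cycle_seq) = is_simple_cycle c.
Proof.
rewrite mem_undup mem_filter; case: (boolP (is_simple_cycle c)) => // sc; rewrite andTb.
apply/eqP; rewrite eqb_id; apply/flatten_mapP.
exists (size c); last by rewrite mem_words.
by rewrite mem_iota add0n ltnS simple_cycle_size.
Qed.

Lemma cycle_balance c v : is_simple_cycle c ->
  \sum_(e : A | tail e == v) (e \in c)%:R = \sum_(e : A | Defs.head e == v) (e \in c)%:R :> R.
Proof.
move=> sc; have uc := simple_cycle_uniq sc.
have h (f : A -> V) : \sum_(e : A | f e == v) (e \in c)%:R =
    (count_mem v [seq f e | e <- c])%:R :> R.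
  rewrite count_map -sum1_count natr_sum big_mkcond/= [RHS]big_mkcond/=.
  rewrite [RHS](big_uniq _ uc)/= [RHS]big_mkcond/=; apply: eq_bigr => e _.
  by case: (f e == v); case: (e \in c).
by rewrite !h; case/andP: sc => /cycle_perm/permP -> _.
Qed.

(** * Circulations without a positive simple cycle *)

Section NoCycle.
Variable l : A -> R.
Hypotheses (l0 : forall e, 0 <= l e).
Hypothesis circ : forall v,
  \sum_(e | tail e == v) l e = \sum_(e | Defs.head e == v) l e.
Hypothesis no_cycle : forall c, is_simple_cycle c -> exists2 e, e \in c & l e = 0.

(** Following edges of positive flow forever must close a simple cycle. *)
Lemma acyclic_circulation_eq0 e : l e = 0.
Proof.
apply/eqP; apply: contraT => le0.
(* [F] moves along a chosen edge of positive flow. Nodes without such an edge are fixed by [F], and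
   [e] is a dummy value of [out] there. *)
pose F v := if [pick a | (tail a == v) && (0 < l a)] is Some a then Defs.head a else v.
pose out v := odflt e [pick a | (tail a == v) && (0 < l a)].
pose active v := [exists a : A, (tail a == v) && (0 < l a)].
have outP v : active v ->
    [/\ tail (out v) = v, 0 < l (out v) & Defs.head (out v) = F v].
  move=> /existsP[a av]; rewrite /out /F; case: pickP => [a' /andP[/eqP]//|].
  by move=> /(_ a); rewrite av.
(* By [circ], what enters the head must leave it. *)
have head_active a : 0 < l a -> active (Defs.head a).
  move=> la; apply: contraT => /existsPn na.
  suff : l a <= 0 by rewrite leNgt la.
  rewrite -(_ : \sum_(i | tail i == Defs.head a) l i = 0); last first.
    apply: big1 => i ti; have := na i; rewrite ti /= -leNgt => li.
    by apply/eqP; rewrite eq_le li l0.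
  by rewrite circ (bigD1 a)//= lerDl sumr_ge0.
have F_active v : active v -> active (F v).
  by move=> /outP[_ lo <-]; exact: head_active.
have iter_active n v : active v -> active (iter n F v).
  by move=> av; elim: n => //= n; exact: F_active.
have v0 : active (Defs.head e) by apply: head_active; rewrite lt_neqAle eq_sym le0 l0.
(* The orbit of the head of [e] consists of distinct nodes and returns to its [i]-th node [y]; the
   [m] nodes from [y] on are the nodes of the cycle. *)
have := looping_order F (Defs.head e); move: (orbit_uniq F (Defs.head e)).
rewrite /orbit /looping; set n := order F (Defs.head e) => un /trajectP[i lin ni].
pose y := iter i F (Defs.head e); pose m := (n - i)%N.
have m0 : (0 < m)%N by rewrite subn_gt0.
have ym : iter m F y = y by rewrite /y -iterD subnK 1?ltnW.
have uy : uniq (traject F y m).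
  by move: un; rewrite -[X in traject _ _ X](subnKC (ltnW lin)) trajectD cat_uniq => /and3P[].
have ay : active y by exact: iter_active.
pose c := [seq out v | v <- traject F y m].
have tc : [seq tail a | a <- c] = traject F y m.
  rewrite -map_comp -[RHS]map_id; apply/eq_in_map => v /trajectP[j _ ->] /=.
  by case: (outP _ (iter_active j _ ay)).
have sc : is_simple_cycle c.
  rewrite /is_simple_cycle tc uy andbT; apply/existsP; exists y.
  move: ym; rewrite /c; case: m m0 {uy tc c} => // m _ ym.
  rewrite /walk_from_to /= last_map last_traject.
  have [-> _ _] := outP _ ay; rewrite eqxx /=.
  have [_ _ ->] := outP _ (iter_active m _ ay); rewrite -iterS ym eqxx andbT.
  elim: m y {ym} ay => //= m ih y' ay'; rewrite ih ?andbT; last exact: F_active.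
  have [_ _ ->] := outP _ ay'; by have [-> _ _] := outP _ (F_active _ ay').
have [a /mapP[v /trajectP[j _ ->] ->] la] := no_cycle sc.
by have [_ + _] := outP _ (iter_active j _ ay); rewrite la ltxx.
Qed.

End NoCycle.

(** The minimum is taken separately at each time, so the edge that peeling empties may vary with
    [x]. *)
Definition bottleneck c k x : R :=
  if c is e :: p then \big[Num.min/k e x]_(a <- p) k a x else 0.

Definition peel c k : A -> R -> R :=
  fun e x => k e x - (e \in c)%:R * bottleneck c k x.

Fixpoint peel_all (cs : seq (seq A)) k :=
  if cs is c :: cs' then peel_all cs' (peel c k) else k.

Fixpoint cycle_rate (cs : seq (seq A)) k w : R -> R :=
  if cs is c :: cs' then
    if w == c then bottleneck c k else cycle_rate cs' (peel c k) w
  else fun _ => 0.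

Lemma bottleneck_le c k x e : e \in c -> bottleneck c k x <= k e x.
Proof.
case: c => // a p; rewrite inE /bottleneck.
have h : \big[Num.min/k a x]_(i <- p) k i x <= k a x.
  by elim: p => [|b p ih]; rewrite ?big_nil ?big_cons// ge_min ih orbT.
case: (eqVneq e a) => [->//|_] /= ep.
elim: p ep {h} => // b p ih; rewrite inE big_cons ge_min.
by case: eqP => [->|_ /ih ->]; rewrite ?lexx ?orbT.
Qed.

Lemma bottleneck_ge0 c k x : (forall e, 0 <= k e x) -> 0 <= bottleneck c k x.
Proof.
move=> k0; case: c => // a p; rewrite /bottleneck.
by elim: p => [|b p ih]; rewrite ?big_nil ?big_cons// le_min k0.
Qed.

Lemma bottleneck_attained c k x : c != [::] ->
  exists2 e, e \in c & k e x = bottleneck c k x.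
Proof.
case: c => // a p _; rewrite /bottleneck; elim: p => [|b p [e ep ke]].
  by exists a; rewrite ?inE ?big_nil.
rewrite big_cons; case: (leP (k b x) (\big[Num.min/k a x]_(i <- p) k i x)) => h.
  by exists b; rewrite ?inE ?eqxx ?orbT.
by exists e => //; move: ep; rewrite !inE => /orP[->//|->]; rewrite !orbT.
Qed.

Lemma measurable_bottleneck c k : (forall e, measurable_fun setT (k e)) ->
  measurable_fun setT (bottleneck c k).
Proof.
move=> mk; case: c => [|a p]; first exact: measurable_cst.
rewrite /bottleneck; elim: p => [|b p ih].
  by under eq_fun do rewrite big_nil; exact: mk.
by under eq_fun do rewrite big_cons; exact: measurable_minr.
Qed.

Lemma nnw_peel c k : nnw k -> nnw (peel c k).
Proof.
move=> [mk k0]; split=> [e|e x].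
  apply: measurable_funB => //; apply: measurable_funM => //.
  exact: measurable_bottleneck.
rewrite subr_ge0; case: (boolP (e \in c)) => ec; last by rewrite mul0r.
by rewrite mul1r bottleneck_le.
Qed.

Lemma measurable_cycle_rate cs k w : nnw k ->
  measurable_fun setT (cycle_rate cs k w).
Proof.
elim: cs k => [|c cs ih] k nk /=; first exact: measurable_cst.
case: eqP => _; last by apply: ih; exact: nnw_peel.
by apply: measurable_bottleneck; case: nk.
Qed.

Lemma cycle_rate_ge0 cs k w x : nnw k -> 0 <= cycle_rate cs k w x.
Proof.
elim: cs k => [//|c cs ih] k nk /=; case: eqP => _; last by apply: ih; exact: nnw_peel.
by apply: bottleneck_ge0; case: nk.
Qed.

Lemma nnw_peel_all cs k : nnw k -> nnw (peel_all cs k).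
Proof. by elim: cs k => //= c cs ih k nk; apply/ih/nnw_peel. Qed.

Lemma peel_all_le cs k e x : nnw k -> peel_all cs k e x <= k e x.
Proof.
elim: cs k => //= c cs ih k nk; apply: le_trans (ih _ (nnw_peel c nk)) _.
by rewrite gerBl mulr_ge0// bottleneck_ge0//; case: nk.
Qed.

(** Peeling [c] empties one of its edges, and later peelings only decrease nonnegative rates, so a
    single pass over all simple cycles is enough. *)
Lemma peel_all_zero cs k c x : nnw k -> c \in cs -> c != [::] ->
  exists2 e, e \in c & peel_all cs k e x = 0.
Proof.
elim: cs k => // c' cs ih k nk; rewrite inE => /orP[/eqP <-|ccs] cn /=; last first.
  exact: ih (nnw_peel _ nk) ccs cn.
have [e ec ke] := bottleneck_attained k x cn; exists e => //.
apply/eqP; rewrite eq_le; apply/andP; split; last by case: (nnw_peel_all cs (nnw_peel c nk)).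
apply: le_trans (peel_all_le _ _ _ (nnw_peel c nk)) _.
by rewrite /peel ec mul1r ke subrr.
Qed.

(** [cycle_rate] reads off the first occurrence of a cycle in [cs], so repetitions must be
    excluded. *)
Lemma peel_allE cs k e x : uniq cs ->
  k e x = \sum_(c <- cs) (e \in c)%:R * cycle_rate cs k c x + peel_all cs k e x.
Proof.
elim: cs k => [|c cs ih] k /=; first by rewrite big_nil add0r.
move=> /andP[ccs ucs]; rewrite big_cons eqxx -addrA.
rewrite (_ : \sum_(_ <- cs) _ = \sum_(j <- cs) (e \in j)%:R * cycle_rate cs (peel c k) j x).
  by rewrite -(ih _ ucs) /peel addrC subrK.
rewrite [LHS]big_seq [RHS]big_seq; apply: eq_bigr => j jcs.
by case: eqP => // jc; rewrite -jc jcs in ccs.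
Qed.

Lemma peel_all_circ cs k x : all (@is_simple_cycle V E) cs ->
  (forall v, \sum_(e | tail e == v) k e x = \sum_(e | Defs.head e == v) k e x) ->
  forall v, \sum_(e | tail e == v) peel_all cs k e x =
            \sum_(e | Defs.head e == v) peel_all cs k e x.
Proof.
elim: cs k => //= c cs ih k /andP[sc scs] ck; apply: ih => // v.
by rewrite /peel !sumrB -!mulr_suml ck cycle_balance.
Qed.

Lemma cycle_decomposition k e x : nnw k ->
  (forall v, \sum_(e | tail e == v) k e x = \sum_(e | Defs.head e == v) k e x) ->
  k e x = \sum_(c <- cycle_seq) (e \in c)%:R * cycle_rate cycle_seq k c x.
Proof.
move=> nk ck; rewrite [LHS](@peel_allE cycle_seq k e x (undup_uniq _)).
rewrite [X in _ + X](_ : _ = 0) ?addr0//.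
apply: (@acyclic_circulation_eq0 (fun e => peel_all cycle_seq k e x)).
- by move=> a; case: (nnw_peel_all cycle_seq nk).
- apply: peel_all_circ => //; apply/allP => c.
  by rewrite mem_cycle_seq.
- move=> c sc; apply: peel_all_zero => //; first by rewrite mem_cycle_seq.
  by case: c sc => // /andP[/existsP[v]].
Qed.

Lemma cycle_rate_le cs k c e x : nnw k -> e \in c -> cycle_rate cs k c x <= k e x.
Proof.
elim: cs k => [|c' cs ih] k nk ec /=; first by case: nk.
case: eqP => [<-|_]; first exact: bottleneck_le.
apply: le_trans (ih _ (nnw_peel _ nk) ec) _.
by rewrite gerBl mulr_ge0// bottleneck_ge0//; case: nk.
Qed.

Lemma cycle_rate_out cs k c x : c \notin cs -> cycle_rate cs k c x = 0.
Proof.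
by elim: cs k => //= c' cs ih k; rewrite inE negb_or => /andP[/negPf -> /ih].
Qed.

End CycleDecomposition.

(** * The flow as a stationary measure of the chain *)

Section Horizon.
Context {R : realType} (tf : R).
Hypothesis tf0 : 0 <= tf.
Local Notation mu := (@lebesgue_measure R).
Local Notation H := (horizon tf).

Definition in_horizon (x : R) : bool := 0 <= x <= tf.

Lemma in_horizonP x : reflect (H x) (in_horizon x).
Proof. by rewrite /horizon /in_horizon /= in_itv; exact: idP. Qed.

Lemma measurable_horizon : measurable H.
Proof. exact: measurable_itv. Qed.

Lemma measurable_in_horizon : measurable_fun setT in_horizon.
Proof.
rewrite (_ : in_horizon = fun x => (0 <= x) && (x <= tf))//.
by apply: measurable_and; apply: measurable_fun_ler => //; exact: measurable_cst.
Qed.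

(** A representative that is nonnegative everywhere and vanishes off the horizon, so that integrals
    can run over the whole line. *)
Definition pos_on (f : R -> R) x : R := if in_horizon x then Num.max (f x) 0 else 0.

Lemma pos_on_ge0 f x : 0 <= pos_on f x.
Proof. by rewrite /pos_on; case: ifP => // _; rewrite le_max lexx orbT. Qed.

Lemma pos_on_out f x : ~~ in_horizon x -> pos_on f x = 0.
Proof. by rewrite /pos_on => /negPf ->. Qed.

Lemma pos_onE f : pos_on f = (fun x => Num.max (f x) 0) \_ H.
Proof.
apply/funext => x; rewrite /pos_on patchE.
case: (in_horizonP x) => Hx; first by rewrite mem_set.
by rewrite memNset.
Qed.

Lemma measurable_pos_on f : L tf f -> measurable_fun setT (pos_on f).
Proof.
move=> /(@measurable_int _ _ _ mu) /measurable_EFinP mf.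
rewrite pos_onE; apply/(measurable_restrictT _ measurable_horizon).
by apply: measurable_maxr => //; exact: measurable_cst.
Qed.

Lemma integral_pos_on f (B : set R) : measurable B -> B `<=` H ->
  (\int[mu]_x ((\1_B x)%:E * (pos_on f x)%:E) =
   \int[mu]_(x in B) (Num.max (f x) 0)%:E)%E.
Proof.
move=> mB BH; rewrite integral_indicM; apply: eq_integral => x /set_mem/BH Hx.
by rewrite /pos_on; case: in_horizonP.
Qed.

Lemma integral_pos_on_lty f : L tf f -> (\int[mu]_x (pos_on f x)%:E < +oo)%E.
Proof.
move=> Lf.
have -> : (\int[mu]_x (pos_on f x)%:E = \int[mu]_(x in H) (Num.max (f x) 0)%:E)%E.
  rewrite -integral_pos_on//; last exact: measurable_horizon.
  apply: eq_integral => x _; rewrite indicE /pos_on.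
  case: in_horizonP => Hx; first by rewrite mem_set ?mul1e.
  by rewrite mule0.
have /integrableP[_] := @integrable_funepos _ _ _ mu _ measurable_horizon _ Lf.
apply: le_lt_trans; apply: ge0_le_integral; first exact: measurable_horizon.
- by move=> x _; rewrite lee_fin le_max lexx orbT.
- apply/measurable_EFinP; apply: measurable_maxr; last exact: measurable_cst.
  by move: Lf => /(@measurable_int _ _ _ mu) /measurable_EFinP.
- apply: measurableT_comp => //; apply: measurable_funepos.
  exact: (@measurable_int _ _ _ mu _ _ Lf).
- by move=> x _; rewrite funeposE /= -EFin_max /= lee_fin ger0_norm// le_max lexx orbT.
Qed.

Lemma Rintegral_pos_on f (B : set R) : Lplus tf f -> measurable B -> B `<=` H ->
  (\int[mu]_(x in B) f x)%:E =
  (\int[mu]_x ((\1_B x)%:E * (pos_on f x)%:E))%E.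
Proof.
move=> [Lf f0] mB BH.
have LfB : mu.-integrable B (EFin \o f).
  exact: (@integrableS _ _ _ mu _ _ _ measurable_horizon mB BH Lf).
rewrite integral_pos_on// /Rintegral fineK; last exact: integrable_fin_num LfB.
have mf : measurable_fun B (EFin \o f) by exact: (@measurable_int _ _ _ mu _ _ LfB).
apply: ae_eq_integral => //.
- apply/measurable_EFinP; apply: measurable_maxr; last exact: measurable_cst.
  exact/measurable_EFinP.
- apply: ae_mono f0 => x fx /BH/fx h.
  by rewrite (max_idPl _).
Qed.

End Horizon.

(** A single interval in the definition already gives continuity, and with it the measurability of
    the traversal times. *)
Lemma absolutely_continuous_within {R : realType} (tf : R) (f : R -> R) :
  absolutely_continuous tf f -> {within horizon tf, continuous f}.
Proof.
move=> ac; apply/subspace_continuousP => x Hx; apply/cvgrPdist_lt => e e0.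
have [del del0 h] := ac _ e0; rewrite near_withinE.
have close y z : horizon tf y -> horizon tf z -> y <= z -> z - y < del ->
    `|f z - f y| < e.
  rewrite /horizon /= !in_itv/= => /andP[y0 _] /andP[_ z1] yz zy.
  have := h 1%N (fun _ => y) (fun _ => z).
  rewrite !big_ord1; apply => // i j; by rewrite !ord1.
apply: filterS (nbhsx_ballx x del del0) => y; rewrite /ball/= => xy Hy.
have [yx|xy'] := leP y x.
  by apply: close => //; rewrite -[_ - _]ger0_norm ?subr_ge0.
rewrite distrC; apply: close => //; first exact: ltW.
by rewrite -[_ - _]ger0_norm ?subr_ge0 1?ltW// distrC.
Qed.

(** Unlike [walk_from_to], this admits the empty walk, as needed for recursion on what follows the
    first edge. *)
Fixpoint chain {V : finType} {E : {set V * V}} (u d : V) (w : seq (edge E)) : bool :=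
  if w is e :: w' then (tail e == u) && chain (Defs.head e) d w' else u == d.

Lemma chain_inj {V : finType} {E : {set V * V}} (u d1 d2 : V) (w : seq (edge E)) :
  chain u d1 w -> chain u d2 w -> d1 = d2.
Proof.
elim: w u => [|e w ih] u /=; first by move=> /eqP <- /eqP <-.
by move=> /andP[_ c1] /andP[_ c2]; exact: ih c1 c2.
Qed.

Lemma walk_from_to_cons {V : finType} (E : {set V * V}) (u d : V) (e : edge E) w :
  walk_from_to u d (e :: w) = (tail e == u) && chain (Defs.head e) d w.
Proof.
rewrite /walk_from_to /= andbCA; congr (_ && _).
by elim: w e => //= e' w ih e; rewrite -andbA ih [_ == tail e']eq_sym.
Qed.

Lemma connect_chain {V : finType} (E : {set V * V}) (u d : V) :
  connect (adj E) u d -> exists w : seq (edge E), chain u d w.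
Proof.
move=> /connectP[p]; elim: p u => [|v p ih] u /=; first by move=> _ ->; exists [::] => /=.
move=> /andP[uv /ih h /h[w cw]].
by exists (Sub (u, v) uv :: w) => /=; rewrite /tail /Defs.head !SubK eqxx.
Qed.

Lemma esum_uniq {R : realType} {I : choiceType} (s : seq I) (a : I -> \bar R) :
  uniq s -> (forall i, 0 <= a i)%E ->
  (\esum_(i in [set` s]) a i = \sum_(i <- s) a i)%E.
Proof.
move=> us a0; rewrite esum_fset//.
by rewrite -fsbig_seq.
Qed.

Lemma esum_words {R : realType} {I : finType} (a : seq I -> \bar R) :
  (forall w, 0 <= a w)%E ->
  (\esum_(w in [set: seq I]) a w = \sum_(n <oo) \sum_(w <- words n) a w)%E.
Proof.
move=> a0; have -> : [set: seq I] = \bigcup_n [set` words n].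
  by apply/seteqP; split => // w _; exists (size w) => //=; rewrite mem_words.
rewrite nneseries_sum_bigcup//; last first.
  move=> i j _ _ [w []] /=; rewrite !mem_words => /eqP <- /eqP <-//.
by apply: eq_eseriesr => n _; rewrite esum_uniq//; exact: uniq_words.
Qed.

(** * The conservation law of the flow in weak form *)

Section Flow.
Context {R : realType} {V : finType} (E : {set V * V}) (s d : V) (tf : R).
Variables (D : edge_rates (R := R) E -> edge_rates (R := R) E) (g : edge_rates (R := R) E).
Hypotheses (tf0 : 0 <= tf) (Dmodel : flow_model tf D).
Hypotheses (flow : sd_flow tf D g s d) (stranded : no_stranded_flow tf D g d).
Local Notation mu := (@lebesgue_measure R).
Local Notation H := (horizon tf).
Local Notation A := (edge E).
Local Notation hd := (@Defs.head V E).
Local Notation inH := (in_horizon tf).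

Let Lg : LplusE tf g. Proof. by case: flow. Qed.

(** The values outside of the horizon are irrelevant. *)
Definition exit_ext (e : A) (x : R) : R := if inH x then exit_time D g e x else x.
Local Notation T := exit_ext.

Definition flow_pos (e : A) : R -> R := pos_on tf (g e).
Local Notation G := flow_pos.

Definition net_rate (v : V) : R -> R := sval (cid (flow.2 v)).

(** If [s = d], the net rates vanish almost everywhere and nothing is routed. *)
Definition inflow (v : V) (x : R) : R :=
  if (v == s) && (s != d) then pos_on tf (net_rate v) x else 0.
Definition outflow (v : V) (x : R) : R :=
  if (v == d) && (s != d) then pos_on tf (fun y => - net_rate v y) x else 0.

Lemma net_rateP v : [/\ L tf (net_rate v),
  forall t, H t ->
    \sum_(e : A | tail e == v) \int[mu]_(x in `[0, t]) g e x
    - \sum_(e : A | hd e == v) \int[mu]_(x in exit_preimage tf D g e t) g e x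
    = \int[mu]_(x in `[0, t]) net_rate v x,
  v = s -> ae_on tf (fun t => 0 <= net_rate v t),
  v = d -> ae_on tf (fun t => net_rate v t <= 0) &
  v != s -> v != d -> ae_on tf (fun t => net_rate v t = 0)].
Proof. by rewrite /net_rate; case: cid. Qed.

Lemma L_opp f : L tf f -> L tf (fun y => - f y).
Proof.
exact: (@integrableN _ _ _ mu H (EFin \o f)).
Qed.

Lemma exit_extE e x : inH x -> T e x = exit_time D g e x.
Proof. by rewrite /T => ->. Qed.

Lemma exit_ext_ge e x : inH x -> x <= T e x.
Proof.
move=> Hx; rewrite exit_extE// /exit_time lerDl.
by apply: (delay_ge0 Dmodel) => //; exact/in_horizonP.
Qed.

Lemma measurable_exit_ext e : measurable_fun setT (T e).
Proof.
have mD : measurable_fun H (D g e).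
  apply: subspace_continuous_measurable_fun; first exact: measurable_horizon.
  exact/absolutely_continuous_within/(delay_abs_cont Dmodel Lg).
have -> : T e = (fun x => x + (D g e \_ H) x).
  apply/funext => x; rewrite /exit_ext patchE.
  case: (in_horizonP tf x) => Hx; first by rewrite mem_set.
  by rewrite memNset// addr0.
apply: measurable_funD; first exact: measurable_id.
exact/(measurable_restrictT _ (measurable_horizon tf)).
Qed.

Lemma nnw_flow : nnw G.
Proof.
split=> [e|e x]; last exact: pos_on_ge0.
by apply: measurable_pos_on; case: (Lg e).
Qed.

Lemma measurable_inflow v : measurable_fun setT (inflow v).
Proof.
rewrite /inflow; case: (_ && _); last exact: measurable_cst.
by apply: measurable_pos_on; case: (net_rateP v).
Qed.

Lemma measurable_outflow v : measurable_fun setT (outflow v).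
Proof.
rewrite /outflow; case: (_ && _); last exact: measurable_cst.
by apply: measurable_pos_on; apply: L_opp; case: (net_rateP v).
Qed.

Lemma inflow_ge0 v x : 0 <= inflow v x.
Proof. by rewrite /inflow; case: ifP => // _; exact: pos_on_ge0. Qed.

Lemma outflow_ge0 v x : 0 <= outflow v x.
Proof. by rewrite /outflow; case: ifP => // _; exact: pos_on_ge0. Qed.

(** The real witnesses record that both integrals are finite, so that conservation becomes a matter
    of real arithmetic. *)
Lemma net_rate_split v (B : set R) : measurable B -> B `<=` H ->
  exists p n : R, [/\ (p%:E = \int[mu]_x ((\1_B x)%:E * (inflow v x)%:E))%E,
    (n%:E = \int[mu]_x ((\1_B x)%:E * (outflow v x)%:E))%E &
    \int[mu]_(x in B) net_rate v x = p - n].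
Proof.
move=> mB BH; have [Lr _ rs rd r0] := net_rateP v.
have zero : (\int[mu]_x ((\1_B x)%:E * (0 : R)%:E) = 0)%E.
  by apply: integral0_eq => x _; rewrite mule0.
have ae0 : ae_on tf (fun t => net_rate v t = 0) -> \int[mu]_(x in B) net_rate v x = 0.
  move=> h; rewrite /Rintegral (@ae_eq_integral _ _ _ mu B (cst 0%E)) ?integral0//.
  - have LrB : mu.-integrable B (EFin \o net_rate v).
      exact: (@integrableS _ _ _ mu _ _ _ (measurable_horizon _) mB BH Lr).
    exact: (@measurable_int _ _ _ mu _ _ LrB).
  - by apply: ae_mono h => x hx /BH/hx ->.
rewrite /inflow /outflow; have [sd|sd] /= := eqVneq s d.
  exists 0, 0; rewrite !andbF zero subr0; split => //; apply: ae0.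
  have [vs|vs] := eqVneq v s; last by apply: r0 => //; rewrite -sd.
  have := ae_and (rs vs) (rd (etrans vs sd)); apply: ae_mono => x [h1 h2] Hx.
  by apply/eqP; rewrite eq_le h1// h2.
rewrite !andbT; have [vs|vs] := eqVneq v s.
  have vd : v == d = false by rewrite vs; exact/negbTE.
  exists (\int[mu]_(x in B) net_rate v x), 0; rewrite vd zero subr0; split => //.
  by apply: Rintegral_pos_on => //; split => //; exact: rs.
have [vd|vd] := eqVneq v d.
  exists 0, (\int[mu]_(x in B) (- net_rate v x)); rewrite zero; split => //.
    apply: Rintegral_pos_on => //; split; first exact: L_opp.
    by apply: ae_mono (rd vd) => x h Hx; rewrite oppr_ge0 h.
  rewrite add0r -mulN1r -RintegralZl//; last first.
    exact: (@integrableS _ _ _ mu _ _ _ (measurable_horizon _) mB BH (L_opp Lr)).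
  by apply: eq_Rintegral => x _; rewrite mulN1r opprK.
by exists 0, 0; rewrite zero subr0; split => //; apply: ae0; exact: r0.
Qed.

Local Notation tl := (@tail V E).
Local Notation b := (throughput tl G outflow).

Lemma throughput_out v x : ~~ inH x -> b v x = 0.
Proof.
move=> Hx; rewrite /throughput big1 => [|e _]; last exact: pos_on_out.
by rewrite add0r /outflow; case: ifP => // _; exact: pos_on_out.
Qed.

Lemma inflow_out v x : ~~ inH x -> inflow v x = 0.
Proof. by move=> Hx; rewrite /inflow; case: ifP => // _; exact: pos_on_out. Qed.

Lemma integral_flow_lty e : (\int[mu]_x (G e x)%:E < +oo)%E.
Proof. by apply: integral_pos_on_lty; case: (Lg e). Qed.

Lemma integral_outflow_lty v : (\int[mu]_x (outflow v x)%:E < +oo)%E.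
Proof.
rewrite /outflow; case: (_ && _); last by rewrite integral0.
by apply: integral_pos_on_lty; apply: L_opp; case: (net_rateP v).
Qed.

Lemma integral_inflow_lty v : (\int[mu]_x (inflow v x)%:E < +oo)%E.
Proof.
rewrite /inflow; case: (_ && _); last by rewrite integral0.
by apply: integral_pos_on_lty; case: (net_rateP v).
Qed.

Let wge (w : R -> R) : measurable_fun setT w -> (forall x, 0 <= w x) ->
  nnmeas (fun x => (w x)%:E).
Proof. by move=> mw w0; split=> [|x]; [exact/measurable_EFinP|rewrite lee_fin]. Qed.

Lemma integral_throughput v (phi : R -> \bar R) : nnmeas phi ->
  (\int[mu]_x (phi x * (b v x)%:E) = \sum_(e | tl e == v)
    \int[mu]_x (phi x * (G e x)%:E) + \int[mu]_x (phi x * (outflow v x)%:E))%E.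
Proof.
move=> nphi; have [mG G0] := nnw_flow.
have nG e : nnmeas (fun x => (phi x * (G e x)%:E)%E).
  by apply: nnmeasM => //; exact: wge.
have no : nnmeas (fun x => (phi x * (outflow v x)%:E)%E).
  by apply: nnmeasM => //; apply: wge; [exact: measurable_outflow|exact: outflow_ge0].
have nif e : nnmeas (fun x => (if tl e == v then phi x * (G e x)%:E else 0)%E).
  by case: (_ == _) => //; exact: nnmeas_cst.
rewrite [X in (_ = X + _)%E]big_mkcond/=.
have -> : (\sum_e (if tl e == v then \int[mu]_x (phi x * (G e x)%:E) else 0) =
    \int[mu]_x (\sum_e (if tl e == v then phi x * (G e x)%:E else 0)))%E.
  rewrite ge0_integral_sum//; last 2 first.
  - by move=> e; case: (nif e).
  - by move=> e x _; case: (nif e).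
  by apply: eq_bigr => e _; case: (_ == _) => //; rewrite integral0.
have [m1 h1] := nnmeas_sum (index_enum A) nif; have [m2 h2] := no.
rewrite -ge0_integralD//; apply: eq_integral => x _.
rewrite -big_mkcond/= -ge0_sume_distrr => [|e _]; last by rewrite lee_fin.
rewrite -ge0_muleDr ?lee_fin ?outflow_ge0//.
  by rewrite sumEFin -EFinD.
by apply: sume_ge0 => e _; rewrite lee_fin.
Qed.

Lemma measurable_exit_preimage e t : measurable (exit_preimage tf D g e t).
Proof.
rewrite (_ : exit_preimage _ _ _ _ _ = H `&` (T e @^-1` `[0, t])).
  apply: measurableI; first exact: measurable_horizon.
  by rewrite -[_ @^-1` _]setTI; apply: measurable_exit_ext => //; exact: measurable_itv.
apply/seteqP; split=> x [Hx] /=; (split => //);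
  by move: b; rewrite exit_extE//; apply/in_horizonP.
Qed.

Lemma balance_itv v t : H t ->
  (\int[mu]_x ((\1_(`[0, t]) x)%:E * (b v x)%:E) = \sum_(e | hd e == v)
    \int[mu]_x ((\1_(`[0%R, t]) (T e x))%:E *
      (if inH (T e x) then G e x else 0%R)%:E)
  + \int[mu]_x ((\1_(`[0%R, t]) x)%:E * (inflow v x)%:E))%E.
Proof.
move=> Ht; have mB : measurable `[0, t]%classic by exact: measurable_itv.
have BH : `[0, t]%classic `<=` H.
  move=> x; move: Ht; rewrite /horizon /= !in_itv/= => /andP[_ tt] /andP[-> xt].
  exact: le_trans xt tt.
have nB : nnmeas (fun x : R => (\1_(`[0, t]) x)%:E : \bar R) by exact: nnmeas_indic.
rewrite integral_throughput//.
have [p [n [pE nE rE]]] := net_rate_split v mB BH.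
have [_ /(_ t Ht) + _ _ _] := net_rateP v; rewrite rE => eqn.
rewrite -pE -nE.
have outE e : (\int[mu]_x ((\1_(`[0%R, t]) x)%:E * (G e x)%:E) =
    (\int[mu]_(x in `[0, t]) g e x)%:E)%E.
  by rewrite (Rintegral_pos_on (Lg e) mB BH).
have inE' e : (\int[mu]_x ((\1_(`[0%R, t]) (T e x))%:E *
      (if inH (T e x) then G e x else 0%R)%:E) =
    (\int[mu]_(x in exit_preimage tf D g e t) g e x)%:E)%E.
  rewrite (Rintegral_pos_on (Lg e) (measurable_exit_preimage e t)); last by move=> x [].
  apply: eq_integral => x _.
  have [Hx|Hx] := boolP (inH x); last first.
    by rewrite /flow_pos pos_on_out// if_same !mule0.
  have -> : \1_(exit_preimage tf D g e t) x = \1_(`[0, t]%classic) (T e x) :> R.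
    rewrite !indicE; congr (_%:R); congr nat_of_bool; rewrite exit_extE//.
    apply/idP/idP => /set_mem h; apply/mem_set; first by case: h => _ [].
    by split => //; exact/in_horizonP.
  (* A time in [[0, t]] is within the horizon, so the guard on [T e x] holds wherever the indicator
     is not 0. *)
  rewrite indicE; case: (boolP (_ \in _)) => [/set_mem/BH h|_]; last by rewrite !mul0e.
  by have -> : inH (T e x) by exact/in_horizonP.
rewrite (eq_bigr _ (fun e _ => outE e)) (eq_bigr _ (fun e _ => inE' e)).
by rewrite !sumEFin -!EFinD; congr EFin; lra.
Qed.

(** Both sides are measure functionals that see [phi] only on the horizon. There the rays []-oo, t]]
    agree with the intervals [[0, t]] of the conservation law, and [mf_eq_ray] passes from rays to
    all test functions. *)
Lemma balance v (phi : R -> \bar R) : nnmeas phi ->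
  (\int[mu]_x (phi x * (b v x)%:E) = \sum_(e | hd e == v)
    \int[mu]_x (phi (T e x) * (if inH (T e x) then G e x else 0%R)%:E)
  + \int[mu]_x (phi x * (inflow v x)%:E))%E.
Proof.
have [mG G0] := nnw_flow.
have mw e : measurable_fun setT (fun x => if inH (T e x) then G e x else 0).
  apply: measurable_fun_ifT; [|exact: mG|exact: measurable_cst].
  by apply: (measurableT_comp (measurable_in_horizon _)); exact: measurable_exit_ext.
have w0 e x : 0 <= (if inH (T e x) then G e x else 0) by case: ifP.
pose Phi (f : R -> \bar R) := (\int[mu]_x (f x * (b v x)%:E))%E.
pose Psi (f : R -> \bar R) := (\sum_(e | hd e == v)
    \int[mu]_x (f (T e x) * (if inH (T e x) then G e x else 0%R)%:E)
  + \int[mu]_x (f x * (inflow v x)%:E))%E.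
have mPhi : measure_functional Phi.
  apply: mf_int; first exact: measurable_id.
    exact: measurable_throughput nnw_flow measurable_outflow v.
  exact: throughput_ge0 nnw_flow outflow_ge0 v.
have mPsi : measure_functional Psi.
  apply: mf_add.
    apply: mf_sum_fun => e; apply: mf_int; first exact: measurable_exit_ext.
      exact: mw.
    exact: w0.
  apply: mf_int; first exact: measurable_id.
    exact: measurable_inflow.
  exact: inflow_ge0.
have local (f f' : R -> \bar R) : (forall x, inH x -> f x = f' x) ->
    Phi f = Phi f' /\ Psi f = Psi f'.
  move=> ff'; split.
    apply: eq_integral => x _; have [/ff' -> //|Hx] := boolP (inH x).
    by rewrite throughput_out// !mule0.
  congr (_ + _)%E.
    apply: eq_bigr => e _; apply: eq_integral => x _.
    by have [/ff' -> //|Hx] := boolP (inH (T e x)); rewrite !mule0.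
  apply: eq_integral => x _; have [/ff' -> //|Hx] := boolP (inH x).
  by rewrite inflow_out// !mule0.
have itv t : H t -> Phi (fun x => (\1_(`[0, t]) x)%:E) = Psi (fun x => (\1_(`[0, t]) x)%:E).
  exact: balance_itv.
have Htf : H tf by apply/(in_horizonP tf tf)/andP; split.
have one (t : R) : tf <= t -> Phi (fun x => (\1_(`]-oo, t]) x)%:E) =
    Psi (fun x => (\1_(`]-oo, t]) x)%:E).
  move=> tft; have [|-> ->] := local (fun x => (\1_(`]-oo, t]) x)%:E)
    (fun x => (\1_(`[0, tf]) x)%:E); last exact: itv.
  move=> x /andP[x0 xt]; rewrite !indicE !mem_setE !in_itv/= x0 xt.
  by rewrite (le_trans xt tft).
have tot : Phi (fun _ => 1%E) = Psi (fun _ => 1%E).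
  have [|-> ->] := local (fun _ => 1%E) (fun x => (\1_(`]-oo, tf]) x)%:E).
    by move=> x /andP[x0 xt]; rewrite indicE mem_setE in_itv/= xt.
  exact: one.
move=> nphi; apply: (@mf_eq_ray _ Phi Psi) => //.
  rewrite /Phi integral_throughput//.
  have h1 : (\sum_(e | tl e == v) \int[mu]_x (1 * (G e x)%:E) < +oo)%E.
    apply: lte_sum_pinfty => e _.
    by under eq_integral => x _ do rewrite mul1e; exact: integral_flow_lty.
  have h2 : (\int[mu]_x (1 * (outflow v x)%:E) < +oo)%E.
    by under eq_integral => x _ do rewrite mul1e; exact: integral_outflow_lty.
  exact: lte_add_pinfty h1 h2.
move=> t; have [tft|ttf] := leP tf t; first exact: one.
have [t0|t0] := leP 0 t.
  have [|-> ->] := local (fun x => (\1_(`]-oo, t]) x)%:E)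
    (fun x => (\1_(`[0, t]) x)%:E); last first.
    by apply: itv; apply/(in_horizonP tf t)/andP; split => //; exact: ltW.
  by move=> x /andP[x0 xt]; rewrite !indicE !mem_setE !in_itv/= x0.
have [|-> ->] := local (fun x => (\1_(`]-oo, t]) x)%:E) (fun _ => 0%E); last first.
  by rewrite (mf0 mPhi) (mf0 mPsi).
move=> x /andP[x0 xt]; rewrite !indicE !mem_setE !in_itv/=.
by rewrite leNgt (lt_le_trans t0 x0).
Qed.

Definition exit_route (v : V) : option (seq A) :=
  if pselect (exists w, chain v d w) is left h then Some (sval (cid h)) else None.

Lemma exit_routeP v w : exit_route v = Some w -> chain v d w.
Proof.
by rewrite /exit_route; case: pselect => // h [<-]; exact: (svalP (cid h)).
Qed.

(** Here [no_stranded_flow] enters: if no route leads from the head of [e] to [d], almost all flow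
    on [e] leaves it by [tf]. *)
Lemma exit_route_ex e : {ae mu, forall x, 0 < G e x -> ~~ inH (T e x) ->
  exit_route (hd e) != None}.
Proof.
have [rt|rt] := eqVneq (exit_route (hd e)) None; last exact: ae_true.
have nc : ~~ connect (adj E) (hd e) d.
  apply/negP => /connect_chain; move: rt; rewrite /exit_route.
  by case: pselect.
apply: ae_mono (stranded nc) => x Hs Gx.
have [Hx|Hx] := boolP (inH x); last by rewrite /flow_pos pos_on_out// ltxx in Gx.
suff -> : inH (T e x) by [].
apply/andP; split.
  by apply: le_trans (exit_ext_ge e Hx); case/andP: Hx.
rewrite exit_extE//; apply: Hs; first exact/in_horizonP.
by move: Gx; rewrite /flow_pos /pos_on Hx lt_max ltxx orbF.
Qed.

(** * Inflow rates of the walks *)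

Local Notation Q := (tail_weight tl hd inH T G outflow exit_route).
Local Notation src := (source tl G inflow outflow).

Let minH := measurable_in_horizon tf.
Let mT := measurable_exit_ext.
Let ng := nnw_flow.
Let mr := measurable_inflow.
Let r0 := inflow_ge0.
Let mrn := measurable_outflow.
Let rn0 := outflow_ge0.

(** A nonzero weight ends either in a factor [leave], which is 0 away from [d], or in a fixed route
    to [d]. *)
Lemma tail_weight_chain e u x : Q e u x != 0 -> chain (hd e) d u.
Proof.
have st w v : ((Some w == exit_route v)%:R : R) != 0 -> chain v d w.
  have [rt _|_] := eqVneq (Some w) (exit_route v); last by rewrite eqxx.
  exact: (exit_routeP (esym rt)).
elim: u e x => [|a u ih] e x /=; case: ifP => _; try exact: st.
- rewrite mulf_eq0 negb_or => /andP[+ _]; rewrite /outflow.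
  by case: ifP => [/andP[hed _] _|_]; last by rewrite eqxx.
- case: (tl a == hd e); last by rewrite eqxx.
  by rewrite mulf_eq0 negb_or => /andP[_ /ih].
Qed.

Definition walk_rate (w : seq A) (x : R) : R :=
  if w is e :: u then src e x * Q e u x else 0.

(** The inequality [s != d] is recorded because it keeps the walk rates off closed walks, where they
    would spoil the zero-cycle condition. *)
Lemma walk_rate_sd w x : walk_rate w x != 0 -> walk_from_to s d w /\ s != d.
Proof.
case: w => [|e u]; first by rewrite eqxx.
rewrite /walk_rate mulf_eq0 negb_or => /andP[+ /tail_weight_chain cu].
rewrite /source mulf_eq0 negb_or => /andP[+ _]; rewrite /inflow.
case: ifP => [/andP[te sd] _|]; last by rewrite eqxx.
by rewrite walk_from_to_cons te.
Qed.

Lemma measurable_walk_rate w : measurable_fun setT (walk_rate w).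
Proof.
case: w => [|e u]; first exact: measurable_cst.
have [ms _] := nnw_source tl ng mr r0 mrn rn0.
apply: measurable_funM; first exact: ms.
exact: measurable_tail_weight.
Qed.

Lemma walk_rate_ge0 w x : 0 <= walk_rate w x.
Proof.
case: w => [//|e u]; have [_ s0] := nnw_source tl ng mr r0 mrn rn0.
by rewrite mulr_ge0//; exact: tail_weight_ge0.
Qed.

Lemma walk_rate_le e u x : walk_rate (e :: u) x <= inflow (tail e) x.
Proof.
have [_ p0] := nnw_turn tl ng mrn rn0.
have p1 a y : turn tl G outflow a y <= 1.
  apply: le_trans (turn_le1 tl G outflow (tail a) y).
  rewrite (bigD1 a)//= -addrA lerDl addr_ge0 ?sumr_ge0//.
  exact: (leave_ge0 tl ng rn0).
have Q1 : Q e u x <= 1.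
  elim: u e x => [|a u ih] e x /=; case: ifP => _; rewrite ?lern1 ?leq_b1//.
    apply: le_trans (turn_le1 tl G outflow (hd e) (T e x)).
    by rewrite lerDr sumr_ge0.
  case: ifP => // _; rewrite mulr_ile1//; exact: tail_weight_ge0.
rewrite /walk_rate /source -mulrA -[leRHS]mulr1 ler_wpM2l//.
by rewrite mulr_ile1//; exact: tail_weight_ge0.
Qed.

(** * Arrival times and the number of visits to an edge *)

Section Arrivals.
Variables (t : R) (Ht : H t).
Local Notation pre := (fun w j => arrival_preimage tf D g w j t).

Lemma arrival_preimage0 w : pre w 0%N = `[0, t]%classic.
Proof.
apply/seteqP; split=> [x [_ [_]]|x xt]; first by rewrite /arrival take0.
split; last by rewrite /arrival take0.
move: Ht xt; rewrite /horizon /= !in_itv/= => /andP[_ tt] /andP[-> xt].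
exact: le_trans xt tt.
Qed.

Lemma arrival_preimageS e u j :
  pre (e :: u) j.+1 = H `&` (T e @^-1` (pre u j)).
Proof.
apply/seteqP; split => x.
  move=> [Hx [Hi ax]]; split => //=.
  have Tx : T e x = exit_time D g e x by rewrite exit_extE//; exact/in_horizonP.
  rewrite Tx; have Hi' i : (i < j)%N -> horizon tf (arrival D g u i (exit_time D g e x)).
    by move=> ij; exact: (Hi i.+1).
  split; last by [].
  (* [arrival_preimage] puts only the arrivals before the last position into the horizon. For
     [j = 0] the exit time of [e] is itself the last arrival, and it lies in [H] because [[0, t]]
     does. *)
  case: j {Hi} ax Hi' => [|j] ax Hi'; last by have := Hi' 0%N isT; rewrite /arrival take0.
  move: Ht ax; rewrite /arrival /= take0 /= /horizon /= !in_itv/= => /andP[_ tt] /andP[-> xt].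
  exact: le_trans xt tt.
move=> [Hx]; rewrite /= exit_extE; last exact/in_horizonP.
move=> [HT [Hi ax]]; split => //; split => // -[|i] ij; first by rewrite /arrival take0.
exact: Hi.
Qed.

Lemma measurable_arrival_preimage w j : (j < size w)%N -> measurable (pre w j).
Proof.
elim: w j => // e u ih [|j] ju; first by rewrite arrival_preimage0; exact: measurable_itv.
rewrite arrival_preimageS; apply: measurableI; first exact: measurable_horizon.
by rewrite -[_ @^-1` _]setTI; apply: mT => //; exact: ih.
Qed.

Variable e0 : A.

Definition visit_number (w : seq A) (x : R) : R :=
  \sum_(j < size w | tnth (in_tuple w) j == e0) \1_(pre w j) x.

Lemma visit_number_ge0 w x : 0 <= visit_number w x.
Proof. by apply: sumr_ge0 => j _; rewrite indicE. Qed.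

Lemma measurable_visit_number w : measurable_fun setT (visit_number w).
Proof.
rewrite /visit_number; under eq_fun do rewrite big_mkcond/=.
apply: measurable_sum => j; case: (_ == _); last exact: measurable_cst.
by apply: measurable_indic; exact: measurable_arrival_preimage.
Qed.

Lemma visit_number_out w x : ~~ inH x -> visit_number w x = 0.
Proof.
move=> Hx; apply: big1 => j _; rewrite indicE memNset// => -[h _].
by move/negP: Hx; apply; exact/in_horizonP.
Qed.

Lemma visit_number_cons e u x : inH x -> visit_number (e :: u) x =
  (e == e0)%:R * \1_(`[0, t]%classic) x + visit_number u (T e x).
Proof.
move=> Hx; rewrite /visit_number big_mkcond big_ord_recl/=.
rewrite arrival_preimage0 (tnth_nth e)/=; congr (_ + _).
  by case: eqP => _; rewrite ?mul1r ?mul0r.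
rewrite [RHS]big_mkcond; apply: eq_bigr => j _.
rewrite (tnth_nth e)/= (tnth_nth e)/= arrival_preimageS; case: eqP => // _.
rewrite !indicE; congr (_%:R); congr nat_of_bool.
apply/idP/idP => /set_mem h; apply/mem_set; first by case: h.
by split => //; exact/in_horizonP.
Qed.

Local Notation f0 := (at_edge e0 (fun x : R => (\1_(`[0, t]%classic) x)%:E : \bar R)).

Lemma tail_count_visit_number e u x : inH x ->
  tail_count inH T f0 e u x = (visit_number (e :: u) x)%:E.
Proof.
have f0E a y : f0 a y = ((a == e0)%:R * \1_(`[0, t]%classic) y)%:E.
  by rewrite /at_edge; case: eqP => _; rewrite ?mul1r ?mul0r.
elim: u e x => [|a u ih] e x Hx; rewrite visit_number_cons//= f0E EFinD.
  by rewrite if_same /visit_number big_ord0.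
congr (_ + _)%E; case: ifPn => Tx; first exact: ih.
by rewrite visit_number_out.
Qed.

Lemma visit_number_still w x : inH x -> (forall e, e \in w -> T e x = x) ->
  visit_number w x = (count_mem e0 w)%:R * \1_(`[0, t]%classic) x.
Proof.
move=> Hx; elim: w => [|e u ih] Tx.
  by rewrite /visit_number big_ord0 mul0r.
rewrite visit_number_cons// Tx ?mem_head// ih => [|a au]; last first.
  by apply: Tx; rewrite inE au orbT.
by rewrite /= natrD mulrDl.
Qed.

Lemma sum_Rintegral_arrival (h : R -> R) w : measurable_fun setT h ->
  (forall x, 0 <= h x) -> (\int[mu]_x (h x)%:E < +oo)%E ->
  (\sum_(j < size w | tnth (in_tuple w) j == e0)
     \int[mu]_(x in pre w j) h x)%:E =
  (\int[mu]_x ((visit_number w x)%:E * (h x)%:E))%E.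
Proof.
move=> mh h0 hfin.
have nh : nnmeas (fun x => (h x)%:E) by exact: wge.
have mp (j : 'I_(size w)) : measurable (pre w j) by exact: measurable_arrival_preimage.
have jE (j : 'I_(size w)) : ((\int[mu]_(x in pre w j) h x)%:E =
    \int[mu]_x ((\1_(pre w j) x)%:E * (h x)%:E))%E.
  rewrite integral_indicM /Rintegral fineK// ge0_fin_numE; last first.
    by apply: integral_ge0 => x _; rewrite lee_fin.
  apply: le_lt_trans hfin; apply: ge0_subset_integral => //.
  - exact: mp.
  - by case: nh.
  - by move=> x _; rewrite lee_fin.
have nj (j : 'I_(size w)) : nnmeas (fun x => (if tnth (in_tuple w) j == e0 then
    (\1_(pre w j) x)%:E * (h x)%:E else 0)%E).
  case: (_ == _); last exact: nnmeas_cst.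
  by apply: nnmeasM => //; exact: nnmeas_indic.
transitivity (\int[mu]_x (\sum_(j < size w) (if tnth (in_tuple w) j == e0 then
    (\1_(pre w j) x)%:E * (h x)%:E else 0)))%E.
  rewrite ge0_integral_sum//; last 2 first.
  - by move=> j; case: (nj j).
  - by move=> j x _; case: (nj j).
  rewrite -sumEFin big_mkcond/=; apply: eq_bigr => j _; case: ifP => _ //.
  by rewrite integral0.
apply: eq_integral => x _; rewrite -big_mkcond/= /visit_number -sumEFin.
rewrite ge0_sume_distrl// => j _; by rewrite lee_fin.
Qed.

End Arrivals.

(** * Assembling the decomposition *)

Lemma integral_rate_lty (h : R -> R) (v : V) (e : A) : measurable_fun setT h ->
  (forall x, 0 <= h x) -> (forall x, h x <= inflow v x + G e x) ->
  (\int[mu]_x (h x)%:E < +oo)%E.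
Proof.
move=> mh h0 hle; have [mG G0] := ng.
have [m1 p1] := wge mh h0; have [m2 p2] := wge (mr v) (r0 v).
have [m3 p3] := wge (mG e) (G0 e).
apply: (@le_lt_trans _ _ (\int[mu]_x ((inflow v x)%:E + (G e x)%:E))%E).
  apply: ge0_le_integral => //; first by apply: emeasurable_funD.
  by move=> x _; rewrite -EFinD lee_fin.
rewrite ge0_integralD//.
exact: lte_add_pinfty (integral_inflow_lty v) (integral_flow_lty e).
Qed.

Lemma L_nonneg (h : R -> R) : measurable_fun setT h -> (forall x, 0 <= h x) ->
  (\int[mu]_x (h x)%:E < +oo)%E -> Lplus tf h.
Proof.
move=> mh h0 hfin; have [m1 p1] := wge mh h0.
split; last by apply: ae_true.
apply: (@integrableS _ _ _ mu setT _ _ measurableT (measurable_horizon tf)) => //.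
apply/integrableP; split => //.
by under eq_integral => x _ do rewrite /= ger0_norm//.
Qed.

(** Sequences outside the index set have walk rate 0, so the sum may run over all words. Sorted by
    length, it is the series of [sum_visit_mass]. *)
Lemma esum_walk_rate (t : R) (e0 : A) : H t ->
  (\esum_(w in sd_walks E s d `|` simple_cycles E)
    \int[mu]_x ((visit_number t e0 w x)%:E * (walk_rate w x)%:E) =
  visits tl hd inH T G inflow outflow
    (at_edge e0 (fun x : R => (\1_(`[0%R, t]%classic) x)%:E)))%E.
Proof.
move=> Ht; set f := at_edge _ _.
have nf : nns f by apply: nns_at; exact: nnmeas_indic.
have f1 e x : (f e x <= 1)%E.
  rewrite /f /at_edge; case: ifP => _; last exact: lee01.
  by rewrite lee_fin indicE; case: (_ \in _); rewrite ?ler01.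
pose a w := (\int[mu]_x ((visit_number t e0 w x)%:E * (walk_rate w x)%:E))%E.
have a0 w : (0 <= a w)%E.
  apply: integral_ge0 => x _; rewrite mule_ge0// lee_fin ?walk_rate_ge0//.
  exact: visit_number_ge0.
transitivity (\esum_(w in [set: seq A]) a w)%E.
  rewrite esum_mkcond; apply: eq_esum => w _; case: ifPn => // /negP wn.
  apply/esym/integral0_eq => x _.
  have [->|/walk_rate_sd[ws _]] := eqVneq (walk_rate w x) 0; first by rewrite mule0.
  by case: wn; apply/mem_set; left.
(* The empty word contributes 0, and a word of length [n + 1] is a first edge followed by a tail in
   [words n]. *)
rewrite esum_words// nneseries_shift; last by move=> n; exact: sume_ge0.
have -> : (\sum_(w <- words 0) a w = 0)%E.
  by rewrite big_seq1; apply: integral0_eq => x _; rewrite mule0.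
rewrite add0e -(sum_visit_mass minH mT ng mr r0 mrn rn0 balance integral_flow_lty
  exit_route_ex nf f1).
apply: eq_eseriesr => n _; rewrite /wsum big_allpairs_dep/= big_enum/=.
apply: eq_bigr => e _.
have [ms s0] := nnw_source tl ng mr r0 mrn rn0.
have nu (u : seq A) : nnmeas (fun x => ((Q e u x)%:E * tail_count inH T f e u x)%E).
  apply: nnmeasM; last exact: nnmeas_tail_count.
  apply: wge; first exact: measurable_tail_weight.
  by move=> x; exact: tail_weight_ge0.
have ns : nnmeas (fun x => (src e x)%:E) by exact: wge.
have nus (u : seq A) := nnmeasM (nu u) ns.
transitivity (\int[mu]_x (\sum_(u <- words n)
    ((Q e u x)%:E * tail_count inH T f e u x) * (src e x)%:E))%E; last first.
  apply: eq_integral => x _; rewrite /visit_mass ge0_sume_distrl//.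
  by move=> u _; case: (nu u).
rewrite ge0_integral_sum//; last 2 first.
- by move=> u; case: (nus u).
- by move=> u x _; case: (nus u).
apply: eq_bigr => u _; apply: eq_integral => x _.
have [Hx|Hx] := boolP (inH x).
  rewrite (tail_count_visit_number Ht e0 e u Hx) /walk_rate EFinM.
  by rewrite [((src e x)%:E * _)%E]muleC muleCA muleA.
by rewrite /walk_rate /source inflow_out// !mul0r !mule0.
Qed.

(** Walk rates account for [m] and cycle rates for [k]. They are added on every sequence because a
    simple cycle can also be an [s],[d]-walk when [s = d]. *)
Lemma flow_decomposition_ex : exists h : seq A -> R -> R,
  flow_decomposition tf D g s d h.
Proof.
have intg := integral_flow_lty.
have [m [k [nm nk visE gmk [kg kst]]]] :=
  visits_residual minH mT ng mr r0 mrn rn0 balance intg.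
have [mk k0] := nk; have [mG G0] := ng.
have Hb x : inH x -> 0 <= x <= tf by [].
have Gout e x : ~~ inH x -> G e x = 0 by exact: pos_on_out.
have kH e x : 0 < k e x -> inH x.
  by move=> kx; apply: contraLR kx => /(Gout e) gx; rewrite -leNgt -gx.
have kT : {ae mu, forall x, forall e, 0 < k e x -> T e x = x}.
  apply: ae_forall => e.
  exact: (residual_no_delay minH mT ng mrn rn0 intg Hb exit_ext_ge Gout
    nk kg kst e).
have kC : {ae mu, forall x, forall v,
    \sum_(e | tl e == v) k e x = \sum_(e | hd e == v) k e x}.
  apply: ae_forall => v.
  exact: (residual_circulation minH mT ng mrn rn0 intg Hb exit_ext_ge Gout
    nk kg kst v).
pose cs := cycle_seq E; pose cyc := cycle_rate cs k.
have mcyc w : measurable_fun setT (cyc w) by exact: measurable_cycle_rate.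
have cyc0 w x : 0 <= cyc w x by exact: cycle_rate_ge0.
have cyc_le w e x : e \in w -> cyc w x <= k e x by exact: cycle_rate_le.
have cyc_nil x : cyc [::] x = 0.
  apply: cycle_rate_out; rewrite mem_cycle_seq.
  by apply/negP => /andP[/existsP[v]].
pose h w x := walk_rate w x + cyc w x.
have mh w : measurable_fun setT (h w).
  by apply: measurable_funD => //; exact: measurable_walk_rate.
have h0 w x : 0 <= h w x by rewrite addr_ge0// walk_rate_ge0.
have hfin w : (\int[mu]_x (h w x)%:E < +oo)%E.
  case: w => [|e u].
    by under eq_integral => x _ do rewrite /h cyc_nil addr0; rewrite integral0.
  apply: (@integral_rate_lty _ (tail e) e) => // x; apply: lerD.
    exact: walk_rate_le.
  by apply: le_trans (kg e x); apply: cyc_le; exact: mem_head.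
exists h; split.
- by move=> w _; exact: L_nonneg.
- move=> e0 t Ht; set WC := (_ `|` _).
  have mB : measurable `[0, t]%classic by exact: measurable_itv.
  have BH : `[0, t]%classic `<=` H.
    move=> x; move: Ht; rewrite /horizon /= !in_itv/= => /andP[_ tt] /andP[-> xt].
    exact: le_trans xt tt.
  have nB : nnmeas (fun x : R => (\1_(`[0, t]) x)%:E : \bar R) by exact: nnmeas_indic.
  set f := at_edge e0 (fun x : R => (\1_(`[0, t]%classic) x)%:E : \bar R).
  have nf : nns f by exact: nns_at.
  have -> : (\int[mu]_(x in `[0, t]) g e0 x)%:E = wsum G f.
    by rewrite wsum_at// (Rintegral_pos_on (Lg e0) mB BH).
  rewrite gmk// -visE// -(esum_walk_rate e0 Ht).
  pose vn := visit_number t e0.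
  have mvn w : measurable_fun setT (vn w) by exact: measurable_visit_number.
  have vn0 w x : 0 <= vn w x by exact: visit_number_ge0.
  pose aw w : \bar R := (\int[mu]_x ((vn w x)%:E * (walk_rate w x)%:E))%E.
  pose ac w : \bar R := (\int[mu]_x ((vn w x)%:E * (cyc w x)%:E))%E.
  have aw0 w : (0 <= aw w)%E.
    by apply: integral_ge0 => x _; rewrite mule_ge0// lee_fin ?walk_rate_ge0.
  have ac0 w : (0 <= ac w)%E.
    by apply: integral_ge0 => x _; rewrite mule_ge0// lee_fin.
  transitivity (\esum_(w in WC) (aw w + ac w))%E; last first.
    apply: eq_esum => w _; rewrite (sum_Rintegral_arrival Ht e0 w (mh w) (h0 w) (hfin w)).
    have nv := wge (mvn w) (vn0 w).
    have nw := wge (measurable_walk_rate w) (walk_rate_ge0 w).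
    have nc := wge (mcyc w) (cyc0 w).
    have [m1 p1] := nnmeasM nv nw; have [m2 p2] := nnmeasM nv nc.
    rewrite -ge0_integralD//; apply: eq_integral => x _.
    by rewrite -ge0_muleDr ?lee_fin ?walk_rate_ge0// -EFinD.
  rewrite esumD//; congr (_ + _)%E; rewrite wsum_at//.
  (* Cycle rates are positive only where, up to null sets, the edges of the cycle have no delay.
     There a simple cycle enters [e0] at the starting time itself, exactly once if [e0] lies on it,
     so [e0 \in w] replaces the number of visits. *)
  pose c w : \bar R := (\int[mu]_x ((\1_(`[0%R, t]%classic) x)%:E *
    ((e0 \in w)%:R * cyc w x)%:E))%E.
  have ce w x : 0 <= (e0 \in w)%:R * cyc w x by rewrite mulr_ge0.
  have nce w : nnmeas (fun x => ((e0 \in w)%:R * cyc w x)%:E).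
    by apply: wge => //; apply: measurable_funM.
  have c0 w : (0 <= c w)%E.
    by apply: integral_ge0 => x _; rewrite mule_ge0// lee_fin.
  transitivity (\esum_(w in [set` cs]) c w)%E; last first.
    rewrite esum_mkcond [RHS]esum_mkcond; apply: eq_esum => w _.
    case: (boolP (w \in [set` cs])) => [/set_mem|/negP] wcs; last first.
      case: ifP => // _; apply/esym/integral0_eq => x _.
      rewrite /cyc cycle_rate_out ?mule0//; apply/negP => wcs'.
      by apply: wcs; exact/mem_set.
    have sw : is_simple_cycle w by rewrite -mem_cycle_seq.
    rewrite ifT; last by apply/mem_set; right.
    have [m1 p1] := nnmeasM nB (nce w).
    have [m2 p2] := nnmeasM (wge (mvn w) (vn0 w)) (wge (mcyc w) (cyc0 w)).
    apply: ge0_ae_eq_integral => //; apply: ae_mono kT => x Tx _.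
    have [->|cx] := eqVneq (cyc w x) 0; first by rewrite mulr0 !mule0.
    have kx e : e \in w -> 0 < k e x.
      by move=> ew; apply: lt_le_trans (cyc_le w e x ew); rewrite lt_neqAle eq_sym cx cyc0.
    have Hx : inH x.
      case: w sw kx {cx m1 p1 m2 p2 wcs} => [/andP[/existsP[v]]//|e u] _ kx.
      by apply: (kH e); apply: kx; exact: mem_head.
    rewrite /vn (visit_number_still Ht) => [|//|e /kx]; last exact: Tx.
    rewrite count_uniq_mem; last exact: simple_cycle_uniq.
    by rewrite -!EFinM mulrCA mulrA.
  rewrite esum_uniq//; last exact: undup_uniq.
  have nBc w := nnmeasM nB (nce w).
  (* For almost every [x] the rates of the cycles through [e0] add up to [k e0 x]; the list is
     finite, so the sum moves inside the integral. *)
  transitivity (\int[mu]_x (\sum_(w <- cs) ((\1_(`[0%R, t]%classic) x)%:E *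
      ((e0 \in w)%:R * cyc w x)%:E)))%E; last first.
    by rewrite ge0_integral_sum// => w *; case: (nBc w).
  have [m1 p1] := nnmeas_sum cs nBc.
  have [m2 p2] := nnmeasM nB (wge (mk e0) (k0 e0)).
  apply: ge0_ae_eq_integral => //; apply: ae_mono kC => x kx _.
  rewrite -ge0_sume_distrr; last by move=> w _; rewrite lee_fin.
  by rewrite sumEFin (cycle_decomposition e0 nk kx).
- move=> c sc; apply: ae_mono kT => x Tx Hx hx e ec.
  (* A cycle returns to its first node, whereas a walk of nonzero rate joins [s] to a different node
     [d]; so [h c] is a pure cycle rate. *)
  have wc0 : walk_rate c x = 0.
    apply/eqP; apply: contraT => /walk_rate_sd[].
    case: c sc {hx ec} => [|a u]; first by case/andP => /existsP[v].
    case/andP => /existsP[v] + _; rewrite !walk_from_to_cons.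
    move=> /andP[/eqP <- cv] /andP[/eqP <- cd].
    by rewrite (chain_inj cv cd) eqxx.
  move: hx; rewrite /h wc0 add0r => cx.
  have kx : 0 < k e x by apply: lt_le_trans (cyc_le c e x ec).
  have := Tx e kx; rewrite exit_extE; last exact/in_horizonP.
  by rewrite /exit_time => /eqP; rewrite -subr_eq0 addrC addKr => /eqP.
Qed.

End Flow.

Theorem theorem2p3 (R : realType) (V : finType) (E : {set V * V}) (s d : V)
    (tf : R) (D : edge_rates (R := R) E -> edge_rates E) (g : edge_rates E) :
  (forall v : V, connect (adj E) s v) ->
  0 <= tf ->
  flow_model tf D ->
  sd_flow tf D g s d ->
  no_stranded_flow tf D g d ->
  exists h : seq (edge E) -> R -> R, flow_decomposition tf D g s d h.
Proof.
move=> _ tf0 Dmodel flow stranded; exact: (flow_decomposition_ex tf0 Dmodel flow stranded).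
Qed.
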